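(* For each $p \in \{3,4,5,\dots\}\cup\{\infty\}$ there is an internally self-dual regular polyhedron of type $\{p,p\}$, and for each $p \in \{4,5,6,\dots\}\cup\{\infty\}$ there is an externally self-dual regular polyhedron of type $\{p,p\}$. Furthermore, if $p \geq 3$ is a (finite) even integer, then there are infinitely many (pairwise non-isomorphic) internally self-dual regular polyhedra of type $\{p,p\}$ and infinitely many (pairwise non-isomorphic) externally self-dual regular polyhedra of type $\{p,p\}$.
   Context: An (abstract) $n$-polytope is a ranked poset $\mathcal P$ (elements: faces; rank-$i$ elements: $i$-faces) such that (i) there is a least face of rank $-1$ and a greatest face of rank $n$; (ii) every maximal chain (called a flag) has exactly $n+2$ faces; (iii) if $F<G$ have ranks $i-1$ and $i+1$, there are exactly two $i$-faces $H$ with $F<H<G$; (iv) $\mathcal P$ is strongly connected: every section $G/F=\{H: F\le H\le G\}$ (including $\mathcal P$) is connected, where a poset satisfying (i) and (ii) with rank $m$ is connected if $m\le 1$ or any two faces other than the least and greatest are joined by a sequence of such faces with consecutive ones comparable. A polyhedron is a $3$-polytope. $\Gamma(\mathcal P)$ is the group of order-preserving bijections of $\mathcal P$ (acting on the right). $\mathcal P$ is regular if $\Gamma(\mathcal P)$ is transitive on flags. For a flag $\Phi$, $\Phi^i$ is the unique flag differing from $\Phi$ in exactly the $i$-face. For regular $\mathcal P$ with a fixed base flag $\Phi$, $\rho_i$ ($0\le i\le n-1$) is the unique automorphism with $\Phi\rho_i=\Phi^i$; these involutions generate $\Gamma(\mathcal P)$. A regular polyhedron has type $\{p,q\}$ if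 its $2$-faces are $p$-gons and its vertex-figures are $q$-gons, i.e. $\rho_0\rho_1$ has order $p$ and $\rho_1\rho_2$ has order $q$ (either may be $\infty$). $\mathcal P$ is self-dual if there is an order-reversing bijection $\mathcal P\to\mathcal P$. For a regular self-dual $n$-polytope, $\alpha\in\Gamma(\mathcal P)$ is dualizing if $\alpha\rho_i=\rho_{n-i-1}\alpha$ for $0\le i\le n-1$. A regular self-dual polytope is internally self-dual if it has a dualizing automorphism, and externally self-dual otherwise. *)

(* Defs.v *)
From HB Require Import structures.
From mathcomp Require Import all_boot all_order all_algebra.
From mathcomp Require Import boolp classical_sets functions cardinality.

Set Implicit Arguments.
Unset Strict Implicit.
Unset Printing Implicit Defensive.

Import Order.TTheory GRing.Theory Num.Theory.

Local Open Scope classical_set_scope.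
Local Open Scope card_scope.
Local Open Scope order_scope.

Definition maximal_chain d (P : porderType d) (C : set P) : Prop :=
  total_on C (fun x y => x <= y) /\
  forall D : set P, total_on D (fun x y => x <= y) -> C `<=` D -> D = C.

Definition covers d (P : porderType d) (x y : P) : Prop :=
  x < y /\ ~ exists z : P, x < z < y.

(* The section G/F, whose rank is rank G - rank F - 1, is connected; its
   faces other than F and G are the H with F < H < G. *)
Definition section_connected d (P : porderType d) (rank : P -> int)
    (F G : P) : Prop :=
  (rank G - rank F - 1 <= 1)%R \/
  forall H K : P, F < H < G -> F < K < G ->
    exists s : seq P, [/\ all (fun L => F < L < G) s,
                          path (>=<%O) H s & last H s = K].

Record polytope (n : nat) : Type := Polytope {
  face_display : Order.disp_t;
  face :> tbPOrderType face_display;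
  rank : face -> int;
  rank_lt : forall F G : face, F < G -> (rank F < rank G)%R;
  rank_covers : forall F G : face, covers F G -> rank G = (rank F + 1)%R;
  rank_least : rank \bot = (- 1)%R;
  rank_greatest : rank \top = n%:Z%R;
  card_maximal_chain : forall C : set face, maximal_chain C -> C #= `I_n.+2;
  diamond : forall F G : face, F < G -> rank G = (rank F + 2)%R ->
    [set H : face | rank H = (rank F + 1)%R /\ F < H < G] #= `I_2;
  strongly_connected : forall F G : face, F <= G -> section_connected rank F G
}.

Section PolytopeTheory.

Variable n : nat.
Implicit Types P Q : polytope n.

Definition flag P (Phi : set P) : Prop := maximal_chain Phi.

Definition isomorphic P Q : Prop :=
  exists f : P -> Q, bijective f /\ {mono f : x y / x <= y}.

(* Automorphisms act on the right: the product of f and g is f \; g, which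
   maps x to g (f x). *)
Definition automorphism P (f : P -> P) : Prop :=
  bijective f /\ {mono f : x y / x <= y}.

Definition self_dual P : Prop :=
  exists f : P -> P, bijective f /\ {mono f : x y /~ x <= y}.

Definition regular P : Prop :=
  forall Phi Psi : set P, flag Phi -> flag Psi ->
    exists2 f : P -> P, automorphism f & f @` Phi = Psi.

(* Psi is the flag Phi^i. *)
Definition adjacent_flag P (i : nat) (Phi Psi : set P) : Prop :=
  [/\ flag Psi, Psi <> Phi &
      forall F : P, rank F <> i%:Z%R -> (Psi F <-> Phi F)].

(* rho 0, ..., rho (n - 1) are the distinguished generators with respect to
   the base flag Phi; the values rho i with n <= i are irrelevant. *)
Definition distinguished_generators P (Phi : set P) (rho : nat -> P -> P) :
    Prop :=
  forall i : nat, (i < n)%N ->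
    automorphism (rho i) /\ adjacent_flag i Phi (rho i @` Phi).

Definition dualizing P (Phi : set P) (alpha : P -> P) : Prop :=
  automorphism alpha /\
  exists2 rho : nat -> P -> P, distinguished_generators Phi rho &
    forall i : nat, (i < n)%N -> alpha \; rho i =1 rho (n - i - 1)%N \; alpha.

(* A change of base flag by an automorphism g conjugates the distinguished
   generators, and the dualizing automorphisms, by g; so for regular P the
   existence of a dualizing automorphism does not depend on Phi. *)
Definition has_dualizing P : Prop :=
  exists2 Phi : set P, flag Phi & exists alpha : P -> P, dualizing Phi alpha.

Definition internally_self_dual P : Prop :=
  [/\ regular P, self_dual P & has_dualizing P].

Definition externally_self_dual P : Prop :=
  [/\ regular P, self_dual P & ~ has_dualizing P].

End PolytopeTheory.

(* In has_order and has_type, None stands for infinity. *)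
Definition has_order (T : Type) (f : T -> T) (p : option nat) : Prop :=
  if p is Some k then
    [/\ (0 < k)%N, iter k f =1 id &
        forall m : nat, (0 < m < k)%N -> ~ (iter m f =1 id)]
  else forall m : nat, (0 < m)%N -> ~ (iter m f =1 id).

(* The Schlaefli type {p,q} of a regular polyhedron; like has_dualizing, it
   does not depend on the base flag. *)
Definition has_type (P : polytope 3) (p q : option nat) : Prop :=
  exists2 Phi : set P, flag Phi &
    exists2 rho : nat -> P -> P, distinguished_generators Phi rho &
      has_order (rho 0 \; rho 1) p /\ has_order (rho 1 \; rho 2) q.

(* b <= p for p in N extended with infinity. *)
Definition at_least (b : nat) (p : option nat) : Prop :=
  if p is Some k then (b <= k)%N else True.

Definition infinitely_many_polyhedra (A : polytope 3 -> Prop) : Prop :=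
  exists P : nat -> polytope 3,
    (forall k, A (P k)) /\ (forall j k, j <> k -> ~ isomorphic (P j) (P k)).

(* Main.v *)
Require Import Defs.
From HB Require Import structures.
From mathcomp Require Import all_boot all_order all_algebra.
From mathcomp Require Import fingroup perm.
From mathcomp Require Import boolp classical_sets functions cardinality.
From mathcomp Require Import zify ring.

(** A regular polyhedron can be recovered from a group with three generating
    involutions rho0, rho1, rho2, of which rho0 and rho2 commute: its faces of
    rank i are the left cosets of the subgroup generated by the rho_j with
    j <> i, and two faces are incident when the cosets meet.  Conversely the
    coset poset is a regular polyhedron as soon as the intersection property
    <rho0, rho1> /\ <rho1, rho2> = <rho1> and mild nondegeneracy conditions
    hold (coset_polyhedron).  Its automorphisms are the left translations
    (automorphism_translate), so that a dualizing automorphism is a group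
    element a with a rho_i = rho_(2-i) a (has_dualizingP).

    All the polyhedra below arise from one recipe, the halving of a map of
    type {4,p}.  Let r0, r1, r2 be involutions such that r0 commutes with r2
    and r1 commutes with r0 r1 r0, and take
    (rho0, rho1, rho2) = (r1, r2, r0 r1 r0).  Conjugation by r0 exchanges rho0
    and rho2 and fixes rho1, so the polyhedron is self-dual, and its type is
    {p,p} where p is the order of r1 r2.  The intersection property becomes a
    condition on the dihedral group D = <r1, r2> alone: D and r0 D r0 meet in
    <r2> (polytopal).

    Let H be the group generated by the rho_i.  If r0 lies in H then r0 is
    dualizing and the polyhedron is internally self-dual.  Since r0 normalizes
    H, this happens as soon as the coset r0 H has an element of odd order
    (odd_relation).  Explicit permutations provide such elements:
    - for p odd, r1 and r2 act on the index set Z_p of Z_p x bool, and r0 flips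
      the bit over every nonzero index; r0 r1 r2 has order p;
    - for p = 4, reflections of the torus Z_m x Z_m with m odd; the product of
      two parallel reflections is a translation of order m;
    - for p even, p >= 6, and for p infinite, a permutation group on Z_p (or Z)
      together with two hubs, lifted to a Z_m-cover with m odd; a product of
      three conjugates of r0 has order dividing 15 m.
    In the last two cases m >= 3 is any odd number and there are at least m
    two-faces, which yields infinitely many finite polyhedra of every even type.

    A polyhedron is externally self-dual when no element of H has the same
    effect on the generators as r0.  When p is even or infinite, the examples
    above can be modified to have this property: adjoin a second factor with
    two blocks of two points, on which r0 exchanges the blocks, r1 flips one of
    them and r2 is trivial (doubled).  Elements of H preserve each block, and
    hence cannot conjugate the flip of one block to the flip of the other.  For
    p odd and at least 5, a wreath product with the symmetric group of degree
    three is used: an element of H acting like r0 can only be r0 itself, but a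
    sign character is trivial on H and not on r0 (three_swaps_external). *)

Set Implicit Arguments.
Unset Strict Implicit.
Unset Printing Implicit Defensive.

Import Order.TTheory GRing.Theory Num.Theory.

Local Open Scope classical_set_scope.
Local Open Scope card_scope.
Local Open Scope order_scope.
Local Open Scope group_scope.
Local Open Scope nat_scope.

(** * Groups generated by involutions *)

Section Generated.

Variables (G : groupType) (rho : nat -> G).

(** The subgroup generated by the rho j with J j. Products of generators
    suffice because every rho j will be an involution. *)
Inductive gen (J : pred nat) : G -> Prop :=
| gen1 : gen J 1%g
| genM x j of gen J x & J j : gen J (x * rho j)%g.

Lemma gen_sub (J J' : pred nat) x :
  (forall j, J j -> rho j <> 1%g -> J' j) -> gen J x -> gen J' x.
Proof.
move=> sJ; elim=> [|y j _ IH Jj]; first exact: gen1.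
have [->|/eqP n1] := eqVneq (rho j) 1%g; first by rewrite mulg1.
by apply: genM => //; apply: sJ.
Qed.

Lemma gen_gen (J : pred nat) j : J j -> gen J (rho j).
Proof. by move=> Jj; rewrite -[rho j]mul1g; apply: genM => //; apply: gen1. Qed.

Lemma gen_mul J x y : gen J x -> gen J y -> gen J (x * y)%g.
Proof.
by move=> Jx; elim=> [|z j _ IH Jj]; rewrite ?mulg1// mulgA; apply: genM.
Qed.

Hypothesis rhoK : forall j, (rho j * rho j = 1)%g.

Lemma rhoV j : ((rho j)^-1 = rho j)%g.
Proof. exact: mulg1_eq. Qed.

Lemma gen_inv J x : gen J x -> gen J x^-1%g.
Proof.
elim=> [|y j _ IH Jj]; first by rewrite invg1; apply: gen1.
by rewrite invgM rhoV; apply: gen_mul => //; apply: gen_gen.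
Qed.

Lemma gen_commute (J : pred nat) x z :
  (forall j, J j -> commute z (rho j)) -> gen J x -> commute z x.
Proof.
move=> cz; elim=> [|y j _ IH Jj]; first exact: commute1.
by apply: commuteM => //; apply: cz.
Qed.

Lemma gen_single (J : pred nat) x i :
  (forall j, J j -> rho j <> 1%g -> j = i) -> gen J x -> x = 1%g \/ x = rho i.
Proof.
move=> Ji; elim=> [|y j _ IH Jj]; first by left.
have [->|/eqP n1] := eqVneq (rho j) 1%g; first by rewrite mulg1.
rewrite (Ji j Jj n1); case: IH => ->; first by rewrite mul1g; right.
by rewrite rhoK; left.
Qed.

Lemma gen_trivial (J : pred nat) x :
  (forall j, J j -> rho j = 1%g) -> gen J x -> x = 1%g.
Proof. by move=> J1; elim=> // y j _ -> /J1 ->; rewrite mulg1. Qed.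

End Generated.

Arguments gen1 {G rho J}.

(** * The coset polyhedron of a string C-group *)

(** The generators are indexed by nat, with trivial values from 3 on, so that
    subgroups can be named by predicates on nat without range conditions. *)
Record string_Cgroup (G : groupType) := StringCgroup {
  rho :> nat -> G;
  rho_ge3 : forall j, 3 <= j -> rho j = 1%g;
  rho_sq : forall j, (rho j * rho j = 1)%g;
  rho_comm : commute (rho 0) (rho 2);
  rho_neq1 : forall j, j < 3 -> rho j <> 1%g;
  rho_neq01 : rho 0 <> rho 1;
  rho_neq21 : rho 2 <> rho 1;
  rho_gen : forall x, gen rho predT x;
  rho_meet : forall x, gen rho (fun j => j < 2) x -> gen rho (fun j => 0 < j) x ->
    x = 1%g \/ x = rho 1 }.

Section CosetPolytope.

Variables (G : groupType) (C : string_Cgroup G).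
Implicit Types (x y z g h a b : G) (r s t j : nat).

Let rhoK := @rho_sq G C.

(** The stabiliser of the base face of rank r - 1. Indexing ranks from 0 to 4
    makes the least and greatest faces uniform with the others: for r = 0 and
    r = 4 no generator is omitted and the stabiliser is the whole group. *)
Definition stab r : G -> Prop := gen C (fun j => j.+1 != r).

Lemma stab1 r : stab r 1%g. Proof. exact: gen1. Qed.

Lemma stabM r x y : stab r x -> stab r y -> stab r (x * y)%g.
Proof. exact: gen_mul. Qed.

Lemma stabV r x : stab r x -> stab r x^-1%g.
Proof. exact: gen_inv rhoK _ _. Qed.

Lemma stab_rho r j : j.+1 != r -> stab r (C j).
Proof. exact: gen_gen. Qed.

Lemma stab_improper r x : r = 0 \/ r = 4 -> stab r x.
Proof.
move=> r04; apply: gen_sub (rho_gen C x) => j _ n1.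
by case: r04 => -> //; apply/eqP => -[j3]; apply: n1; rewrite rho_ge3 ?j3.
Qed.

Lemma rho_commute i j : i.+1 < j -> commute (C i) (C j).
Proof.
have [j3|j3] := leqP 3 j; first by rewrite (rho_ge3 C j3) => _; exact: commute1.
case: i j j3 => [|i] [|[|[|]]] //; by move=> _ _; apply: rho_comm.
Qed.

(** Distant generators commute, so the ones above a rank can be moved to the
    left of the ones below it. Transitivity of incidence and the description
    of flags both rest on this. *)
Lemma stab_factor s g : stab s g ->
  exists a b, [/\ g = (a * b)%g, gen C (fun j => s <= j) a
                  & gen C (fun j => j.+1 < s) b].
Proof.
elim=> [|x j _ [a [b [-> ga gb]]] js].
  by exists 1%g, 1%g; rewrite mulg1; split=> //; apply: gen1.
have [sj|sj] := leqP s j.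
  exists (a * C j)%g, b; split=> //; last exact: genM.
  rewrite -!mulgA; congr (_ * _)%g; apply: commute_sym.
  apply: gen_commute gb => i ij; apply/commute_sym/rho_commute.
  exact: leq_trans ij sj.
exists a, (b * C j)%g; split; rewrite ?mulgA//; apply: genM => //.
by rewrite ltn_neqAle js.
Qed.

Lemma stab_factor2 r s t g : r <= s -> s <= t -> stab s g ->
  exists a b, [/\ g = (a * b)%g, stab r a & stab t b].
Proof.
move=> rs st /stab_factor[a [b [-> ga gb]]]; exists a, b; split=> //.
  apply: gen_sub ga => j sj _; rewrite gtn_eqF// ltnS.
  exact: leq_trans rs sj.
apply: gen_sub gb => j sj _; rewrite ltn_eqF//.
exact: leq_trans sj st.
Qed.

Lemma stab13 x : stab 1 x -> stab 3 x -> x = 1%g \/ x = C 1.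
Proof.
move=> x1 x3; apply: (@rho_meet _ C).
  by apply: gen_sub x3 => -[|[|[|j]]]// _; rewrite rho_ge3.
by apply: gen_sub x1 => -[|j].
Qed.

Lemma gen_high a : gen C (fun j => 1 < j) a -> a = 1%g \/ a = C 2.
Proof.
by apply: (gen_single rhoK) => -[|[|[|j]]]// _; rewrite rho_ge3.
Qed.

Lemma gen_low b : gen C (fun j => j.+1 < 2) b -> b = 1%g \/ b = C 0.
Proof. by apply: (gen_single rhoK) => -[|j]. Qed.

(** Between two incident faces two ranks apart there are at most two faces. *)
Lemma stab_middle r x : r < 3 -> stab r x -> stab r.+2 x ->
  stab r.+1 x \/ stab r.+1 (C r * x)%g.
Proof.
case: r => [|[|[|]]]// _ xr xr2.
- have [a [b [def_x ga gb]]] := stab_factor xr2.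
  have a1 : stab 1 a by apply: gen_sub ga => -[|[|j]].
  have ca : commute (C 0) a.
    by apply: gen_commute ga => -[|[|j]]// _; apply: rho_commute.
  have [b1|b1] := gen_low gb; first by left; rewrite def_x b1 mulg1.
  by right; rewrite def_x b1 mulgA ca -mulgA rhoK mulg1.
- have [->|->] := stab13 xr xr2; first by left; apply: stab1.
  by right; rewrite rhoK; apply: stab1.
- have [a [b [def_x ga gb]]] := stab_factor xr.
  have b3 : stab 3 b by apply: gen_sub gb => -[|[|j]].
  have [a1|a1] := gen_high ga; first by left; rewrite def_x a1 mul1g.
  by right; rewrite def_x a1 mulgA rhoK mul1g.
Qed.

(** The two faces between incident faces two ranks apart are distinct. *)
Lemma rho_notin_stab j : j < 3 -> ~ stab j.+1 (C j).
Proof.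
have n0 := @rho_neq1 _ C 0 isT; have n2 := @rho_neq1 _ C 2 isT.
case: j => [|[|[|]]]// _.
- have m := stab_rho (isT : 1 != 3) => /stab13/(_ m).
  by case=> [/n0|/(@rho_neq01 _ C)].
- move/stab_factor=> [a [b [def ga gb]]].
  have b3 : stab 3 b by apply: gen_sub gb => -[|[|j]].
  have a1 : stab 1 a by apply: gen_sub ga => -[|[|j]].
  have r11 : stab 1 (C 1) by apply: stab_rho.
  have r13 : stab 3 (C 1) by apply: stab_rho.
  have [a_1|a_2] := gen_high ga.
    have [b1|b1] := gen_low gb.
      by apply: (@rho_neq1 _ C 1); rewrite // def a_1 b1 mul1g.
    by apply: (@rho_neq01 _ C); rewrite def a_1 b1 mul1g.
  have : stab 3 a.
    by rewrite -[a](mulgK b) -def; apply: stabM => //; apply: stabV.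
  by move/(stab13 a1); rewrite a_2; case=> [/n2|/(@rho_neq21 _ C)].
- have m := stab_rho (isT : 2.+1 != 1) => /(stab13 m).
  by case=> [/n2|/(@rho_neq21 _ C)].
Qed.

Lemma stab_all x : stab 1 x -> stab 2 x -> stab 3 x -> x = 1%g.
Proof.
move=> x1 x2 x3; have [//|x_1] := stab13 x1 x3.
by case: (@rho_notin_stab 1 isT); rewrite -x_1.
Qed.

Definition coset r h : set G := [set x | stab r (h^-1 * x)%g].

Lemma coset_eq r h x : coset r h x -> coset r h = coset r x.
Proof.
move=> hx; apply/seteqP; split=> y; rewrite /coset /= in hx * => hy.
  have -> : (x^-1 * y = (h^-1 * x)^-1 * (h^-1 * y))%g by rewrite invgM invgK !gnorm.
  by apply: stabM => //; apply: stabV.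
by rewrite -[y](mulVKg x) mulgA; apply: stabM.
Qed.

Lemma coset_id r x : coset r x x.
Proof. by rewrite /coset /= mulVg; apply: stab1. Qed.

(** A face carries its rank: cosets of different stabilisers may coincide as
    sets, as for the least and greatest faces. *)
Record cface := CFace {
  idx : 'I_5;
  cset : set G;
  _ : exists h, cset = coset idx h }.

Definition coset_face (i : 'I_5) h : cface :=
  CFace (ex_intro (fun h' => coset i h = coset i h') h erefl).

Lemma cface_eq F F' : idx F = idx F' -> cset F = cset F' -> F = F'.
Proof.
case: F F' => [i A e] [i' A' e'] /= ei eA.
by subst; congr CFace; apply: Prop_irrelevance.
Qed.

Lemma coset_face_eq F x : cset F x -> F = coset_face (idx F) x.
Proof.
case: F => [i A [h /= defA]] Ax; apply: cface_eq => //=.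
by rewrite defA; apply: coset_eq; rewrite -defA.
Qed.

Lemma in_coset_face i x : cset (coset_face i x) x. Proof. exact: coset_id. Qed.

Lemma cset_nonempty F : exists x, cset F x.
Proof. by case: F => [i A [h /= ->]]; exists h; apply: coset_id. Qed.

HB.instance Definition _ := gen_eqMixin cface.
HB.instance Definition _ := gen_choiceMixin cface.

Definition cface_le (F F' : cface) :=
  (idx F <= idx F') && `[< exists x, cset F x /\ cset F' x >].

Lemma cface_leP F F' :
  reflect (idx F <= idx F' /\ exists x, cset F x /\ cset F' x) (cface_le F F').
Proof.
by apply: (iffP andP) => [[? /asboolP]|[? ?]]; split=> //; apply/asboolP.
Qed.

Lemma cface_le_refl : reflexive cface_le.
Proof. by move=> F; apply/cface_leP; split=> //; have [x] := cset_nonempty F; exists x. Qed.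

Lemma same_idx F F' x : idx F = idx F' -> cset F x -> cset F' x -> F = F'.
Proof. by move=> e /coset_face_eq-> /coset_face_eq ->; rewrite e. Qed.

Lemma cface_le_anti : antisymmetric cface_le.
Proof.
move=> F F' /andP[/cface_leP[l1 [x [x1 x2]]] /cface_leP[l2 _]].
by apply: same_idx x1 x2; apply/val_inj/eqP; rewrite eqn_leq l1.
Qed.

Lemma cface_le_trans : transitive cface_le.
Proof.
move=> F' F F'' /cface_leP[l1 [x [x1 x2]]] /cface_leP[l2 [y [y2 y3]]].
apply/cface_leP; split; first exact: leq_trans l1 l2.
have : stab (idx F') (x^-1 * y)%g.
  by move: y2; rewrite (coset_face_eq x2).
move=> /(stab_factor2 l1 l2)[a [b [e ga gb]]]; exists (x * a)%g; split.
  by rewrite (coset_face_eq x1) /= /coset /= mulKg.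
rewrite (coset_face_eq y3) /= /coset /=.
have -> : (x * a = y * b^-1)%g by apply: (@mulIg _ b); rewrite mulgVK -mulgA -e mulVKg.
by rewrite mulKg; apply: stabV.
Qed.

Lemma cface_le_display : Order.disp_t. Proof. exact: Order.Disp tt tt. Qed.

HB.instance Definition _ :=
  Order.Le_isPOrder.Build cface_le_display cface cface_le_refl cface_le_anti cface_le_trans.

Lemma cface_leE (F F' : cface) : (F <= F')%O = cface_le F F'. Proof. by []. Qed.

Lemma coset_improper r h x : r = 0 \/ r = 4 -> coset r h x.
Proof. by move=> r04; apply: stab_improper. Qed.

Lemma cface_le_bot (F : cface) : (coset_face ord0 1%g <= F)%O.
Proof.
rewrite cface_leE; apply/cface_leP; split=> //; have [x] := cset_nonempty F.
by exists x; split=> //; apply: coset_improper; left.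
Qed.

Lemma cface_le_top (F : cface) : (F <= coset_face ord_max 1%g)%O.
Proof.
rewrite cface_leE; apply/cface_leP; split=> /=; first by rewrite -ltnS.
by have [x] := cset_nonempty F; exists x; split=> //; apply: coset_improper; right.
Qed.

HB.instance Definition _ := Order.hasBottom.Build cface_le_display cface cface_le_bot.
HB.instance Definition _ := Order.hasTop.Build cface_le_display cface cface_le_top.

Lemma cface_le_common F F' x : idx F <= idx F' -> cset F x -> cset F' x -> (F <= F')%O.
Proof. by move=> l x1 x2; rewrite cface_leE; apply/cface_leP; split=> //; exists x. Qed.

Lemma comparable_common (F F' : cface) x :
  cset F x -> cset F' x -> (F >=< F')%O.
Proof.
move=> x1 x2; rewrite /Order.comparable.
by case: (leqP (idx F) (idx F')) => [|/ltnW] l;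
  [rewrite (cface_le_common l x1 x2)|rewrite (cface_le_common l x2 x1) orbT].
Qed.

Lemma cface_lt_common F F' x : idx F < idx F' -> cset F x -> cset F' x -> (F < F')%O.
Proof.
move=> l x1 x2; rewrite lt_neqAle (cface_le_common (ltnW l) x1 x2) andbT.
by apply: contraTneq l => ->; rewrite ltnn.
Qed.

Lemma cface_lt_idx (F F' : cface) : (F < F')%O -> idx F < idx F'.
Proof.
rewrite lt_neqAle cface_leE => /andP[neq /cface_leP[l [x [x1 x2]]]].
rewrite ltn_neqAle l andbT; apply: contra neq => /eqP e.
by apply/eqP; apply: same_idx x1 x2; apply: val_inj.
Qed.

Local Notation chain A := (total_on A (fun F F' : cface => (F <= F')%O)).

(** The cosets of a chain have a common element, not just pairwise: an
    element of the lower faces is corrected inside the stabiliser of the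
    topmost of them, where a factor lying in all the lower stabilisers can be
    split off. Hence flags correspond to group elements. *)
Lemma chain_common (A : set cface) : chain A -> exists x, forall F, A F -> cset F x.
Proof.
move=> totA.
suff: forall n, exists x, forall F, A F -> idx F < n -> cset F x.
  by move=> /(_ 5)[x Ax]; exists x => F AF; apply: Ax.
elim=> [|n [x xA]]; first by exists 1%g.
have [|noF] := pselect (exists2 F, A F & idx F = n :> nat); last first.
  exists x => F AF; rewrite ltnS leq_eqVlt => /predU1P[e|]; last exact: xA.
  by case: noF; exists F.
case=> F AF idF.
have uniqF F' : A F' -> idx F' = n :> nat -> F' = F.
  move=> AF' e; have e' : idx F' = idx F by apply: val_inj; rewrite /= e.
  by case: (totA _ _ AF AF') => /cface_leP[_ [y [y1 y2]]]; [symmetry|];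
     apply: same_idx y1 y2.
(* s will be the highest index below n of a face in the chain. *)
pose p s := `[< exists F', [/\ A F', idx F' = s :> nat & s < n] >].
have [[s ps]|nop] := pselect (exists s, p s); last first.
  have [y Fy] := cset_nonempty F; exists y => F' AF'.
  rewrite ltnS leq_eqVlt => /predU1P[/(uniqF _ AF') -> //|l].
  by case: nop; exists (idx F'); apply/asboolP; exists F'.
have bnd i : p i -> i <= n by move=> /asboolP[F' [_ _ /ltnW]].
case: (ex_maxnP (ex_intro _ s ps) bnd) => {ps}s /asboolP[L [AL idL ltsn]] max_s.
have /cface_leP[l [y [Ly Fy]]] : (L <= F)%O.
  by case: (totA _ _ AL AF) => // /cface_leP[+ _]; rewrite idL idF leqNgt ltsn.
have Lx : cset L x by apply: xA; rewrite ?idL.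
have : stab s (x^-1 * y)%g by move: Ly; rewrite (coset_face_eq Lx) -idL.
move=> /stab_factor[a [b [e ga gb]]]; exists (x * a)%g => F' AF'.
rewrite ltnS leq_eqVlt => /predU1P[/(uniqF _ AF') ->|l'].
  rewrite (coset_face_eq Fy) /= /coset /=.
  have -> : (x * a = y * b^-1)%g
    by apply: (@mulIg _ b); rewrite mulgVK -mulgA -e mulVKg.
  rewrite mulKg; apply: stabV; apply: gen_sub gb => j js _.
  by rewrite idF ltn_eqF// (leq_trans js (ltnW ltsn)).
have F'x := xA _ AF' l'; rewrite (coset_face_eq F'x) /= /coset /= mulKg.
apply: gen_sub ga => j sj _; rewrite gtn_eqF// ltnS (leq_trans _ sj)//.
by apply: max_s; apply/asboolP; exists F'.
Qed.

Definition flagset x : set cface := [set F | cset F x].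

Lemma flagset_chain x : chain (flagset x).
Proof.
by move=> F F' x1 x2; apply/orP/(comparable_common x1 x2).
Qed.

Lemma flagset_eq x y : flagset x `<=` flagset y -> x = y.
Proof.
move=> sub; have H (r : 'I_5) : stab r (x^-1 * y)%g := sub (coset_face r x) (in_coset_face r x).
apply: (@mulgI _ x^-1%g); rewrite mulVg; apply/esym/stab_all.
- by have := H (inord 1); rewrite inordK.
- by have := H (inord 2); rewrite inordK.
- by have := H (inord 3); rewrite inordK.
Qed.

Lemma maximal_chainP (A : set cface) :
  maximal_chain A <-> exists x, A = flagset x.
Proof.
split=> [[totA maxA]|[x ->]].
  have [x Ax] := chain_common totA; exists x.
  by apply/esym/maxA => //; apply: flagset_chain.
split=> [|B totB subB]; first exact: flagset_chain.
have [y By] := chain_common totB; apply/seteqP; split=> // F BF.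
rewrite (@flagset_eq x y); first exact: By.
by move=> F' /subB/By.
Qed.

Lemma card_flag (A : set cface) : maximal_chain A -> A #= `I_5.
Proof.
move=> /maximal_chainP[x ->].
have -> : flagset x = (fun n => coset_face (inord n) x) @` `I_5.
  apply/seteqP; split=> [F Fx|F [n _ <-]]; last exact: in_coset_face.
  exists (idx F); first exact: (ltn_ord (idx F)).
  by rewrite inord_val -(coset_face_eq Fx).
apply: inj_card_eq => m n; rewrite !inE /= => m5 n5 /(congr1 (fun F => idx F : nat)).
by rewrite /= !inordK.
Qed.

Definition rankf (F : cface) : int := (Posz (idx F) - 1)%R.

Lemma rankf_eq (F F' : cface) k : (rankf F' = rankf F + Posz k)%R <->
  idx F' = idx F + k :> nat.
Proof.
rewrite /rankf; split=> [/(congr1 (+%R^~ 1%R))|->]; last by rewrite PoszD addrAC.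
by rewrite subrK addrAC subrK -PoszD => -[].
Qed.

Lemma rankf_lt (F F' : cface) : (F < F')%O -> (rankf F < rankf F')%R.
Proof. by move/cface_lt_idx => l; rewrite ltrD2r ltz_nat. Qed.

Lemma inord_idx k (F : cface) : k <= idx F -> (inord k : 'I_5) = k :> nat.
Proof. by move=> kF; rewrite inordK// ltnS (leq_trans kF)// -ltnS. Qed.

Lemma cface_ltP (F F' : cface) : (F < F')%O ->
  idx F < idx F' /\ exists2 x, cset F x & cset F' x.
Proof.
move=> lt; split; first exact: cface_lt_idx.
by have /cface_leP[_ [x [x1 x2]]] := ltW lt; exists x.
Qed.

Lemma rankf_covers (F F' : cface) : covers F F' -> (rankf F' = rankf F + 1)%R.
Proof.
case=> /cface_ltP[l [x x1 x2]] nobtw; apply/(rankf_eq F F' 1)/eqP.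
rewrite addn1 eqn_leq l andbT leqNgt; apply/negP => l2; apply: nobtw.
have e := inord_idx (ltnW l2); exists (coset_face (inord (idx F).+1) x); apply/andP; split.
  by apply: cface_lt_common x1 (in_coset_face _ _); rewrite /= e.
by apply: cface_lt_common (in_coset_face _ _) x2; rewrite /= e.
Qed.

Lemma middle_faces (F F' M : cface) x :
  idx F' = (idx F).+2 :> nat -> cset F x -> cset F' x ->
  idx M = (idx F).+1 :> nat /\ (F < M < F')%O <->
  M = coset_face (inord (idx F).+1) x \/ M = coset_face (inord (idx F).+1) (x * C (idx F))%g.
Proof.
move=> e Fx F'x; have e1 : (inord (idx F).+1 : 'I_5) = (idx F).+1 :> nat.
  by apply: (@inord_idx _ F'); rewrite e.
have F3 : idx F < 3 by rewrite -ltnS -ltnS -e ltn_ord.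
have mid y : cset F y -> cset F' y -> idx (coset_face (inord (idx F).+1) y) = (idx F).+1 :> nat
    /\ (F < coset_face (inord (idx F).+1) y < F')%O.
  move=> Fy F'y; split=> //; apply/andP; split.
    by apply: cface_lt_common Fy (in_coset_face _ _); rewrite /= e1.
  by apply: cface_lt_common (in_coset_face _ _) F'y; rewrite /= e1 e.
split=> [[eM /andP[FM MF']]|[]->]; last 2 first.
- exact: mid.
- apply: mid.
    by rewrite (coset_face_eq Fx) /= /coset /= mulKg; apply: stab_rho; rewrite neq_ltn ltnSn orbT.
  rewrite (coset_face_eq F'x) /= /coset /= mulKg; apply: stab_rho.
  by rewrite e neq_ltn ltnSn.
have [y ymem] : exists y, forall L, [set F; M; F'] L -> cset L y.
  apply: chain_common => A B /= [[->|->]|->] [[->|->]|->];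
    rewrite ?lexx ?(ltW FM) ?(ltW MF') ?(ltW (lt_trans FM MF'));
    by [left|right|left].
have Fy : cset F y by apply: ymem; left; left.
have My : cset M y by apply: ymem; left; right.
have F'y : cset F' y by apply: ymem; right.
have eM' : idx M = inord (idx F).+1 by apply: val_inj; rewrite /= eM e1.
have st1 : stab (idx F) (x^-1 * y)%g by move: Fy; rewrite (coset_face_eq Fx).
have st2 : stab (idx F).+2 (x^-1 * y)%g by move: F'y; rewrite -e (coset_face_eq F'x).
have [s1|s1] := stab_middle F3 st1 st2; [left|right];
  apply: (@same_idx _ _ y) => //; rewrite /= /coset /= e1 // invgM rhoV//.
by rewrite -mulgA.
Qed.

Lemma card_middle (F F' : cface) : (F < F')%O -> (rankf F' = rankf F + 2)%R ->
  [set M : cface | (rankf M = rankf F + 1)%R /\ (F < M < F')%O] #= `I_2.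
Proof.
move=> /cface_ltP[_ [x Fx F'x]] /(rankf_eq F F' 2); rewrite addn2 => e.
have F3 : idx F < 3 by rewrite -ltnS -ltnS -e ltn_ord.
have e1 : (inord (idx F).+1 : 'I_5) = (idx F).+1 :> nat.
  by apply: (@inord_idx _ F'); rewrite e.
set A := [set M | _].
have -> : A = (fun n => coset_face (inord (idx F).+1) (x * C (idx F) ^+ n)%g) @` `I_2.
  apply/seteqP; split=> [M [/(rankf_eq F M 1)]|M [n n2 <-]].
    rewrite addn1 => eM lt; have /(middle_faces M e Fx F'x) := conj eM lt.
    by case=> ->; [exists 0 => //; rewrite expg0 mulg1 | exists 1 => //; rewrite expg1].
  have [eM lt] : idx (coset_face (inord (idx F).+1) (x * C (idx F) ^+ n)%g) = (idx F).+1 :> nat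
     /\ (F < coset_face (inord (idx F).+1) (x * C (idx F) ^+ n)%g < F')%O.
    apply/(middle_faces _ e Fx F'x).
    by case: n n2 => [|[|]]// _; [left; rewrite expg0 mulg1|right; rewrite expg1].
  by split=> //; apply/(rankf_eq F _ 1); rewrite addn1.
apply: inj_card_eq => m n; rewrite !inE /= => m2 n2 /(congr1 cset)/= E.
have neq : coset (inord (idx F).+1 : 'I_5) x <>
    coset (inord (idx F).+1 : 'I_5) (x * C (idx F))%g.
  move=> E'; have := coset_id (inord (idx F).+1 : 'I_5) (x * C (idx F))%g.
  by rewrite -E' /coset /= mulKg e1; apply: rho_notin_stab.
case: m n m2 n2 E => [|[|]]// [|[|]]// _ _; rewrite expg0 expg1 mulg1.
  by move/neq.
by move/esym/neq.
Qed.

Lemma coset_face_between (F F' : cface) x (i : 'I_5) : cset F x -> cset F' x ->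
  idx F < i -> i < idx F' -> (F < coset_face i x < F')%O.
Proof.
move=> Fx F'x l1 l2; apply/andP; split; first exact: cface_lt_common Fx (in_coset_face _ _).
exact: cface_lt_common (in_coset_face _ _) F'x.
Qed.

(** This fails for r = 0 and t = 2, since C 2 also fixes both faces, but only
    the sections with r + 3 <= t have to be shown connected. *)
Lemma stab_section r t x : r + 3 <= t -> t <= 4 -> stab r x -> stab t x ->
  gen C (fun j => (r <= j) && (j.+1 < t)) x.
Proof.
rewrite addn3 => rt t4; case: t t4 rt => [|[|[|[|[|t]]]]]// _; case: r => [|[|r]]//.
- move=> _ _ /stab_factor[a [b [-> ga gb]]].
  rewrite (_ : a = 1%g) ?mul1g; first exact: gen_sub gb.
  by apply: gen_trivial ga => j; apply: rho_ge3.
- move=> _ _ _; apply: gen_sub (rho_gen C x) => -[|[|[|j]]]// _.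
  by rewrite rho_ge3.
- move=> _ /stab_factor[a [b [-> ga gb]]] _.
  rewrite (_ : b = 1%g) ?mulg1; last by apply: gen_trivial gb.
  by apply: gen_sub ga => -[|[|[|j]]]// _; rewrite rho_ge3.
Qed.

(** Right multiplication by a generator only changes the face of one rank,
    and an open section of rank at least 2 has a face of another rank through
    which to connect. *)
Lemma section_path (F F' : cface) x g (i i' : 'I_5) :
  idx F + 3 <= idx F' -> cset F x -> cset F' x ->
  gen C (fun j => (idx F <= j) && (j.+1 < idx F')) g ->
  idx F < i -> i < idx F' -> idx F < i' -> i' < idx F' ->
  exists s : seq cface, [/\ all (fun L => F < L < F')%O s,
    path (>=<%O) (coset_face i x) s & last (coset_face i x) s = coset_face i' (x * g)%g].
Proof.
move=> l3 Fx F'x gg Fi iF'; elim: gg i' => [|h j gh IH /andP[Fj jF']] i' Fi' i'F'.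
  rewrite mulg1; exists [:: coset_face i' x]; split=> //=.
    by rewrite coset_face_between.
  by rewrite andbT; apply: comparable_common (in_coset_face _ _) (in_coset_face _ _).
  (* A rank strictly inside the section that multiplication by C j leaves
     fixed. *)
  have [k [Fk kF' kj]] : exists k : 'I_5, [/\ idx F < k, k < idx F' & k != j.+1 :> nat].
    pose k := if j == idx F then (idx F).+2 else (idx F).+1.
    have kl : k < idx F' by rewrite /k; case: eqP l3 => _; rewrite addn3 => // /ltnW.
    exists (inord k); rewrite (inord_idx (ltnW kl)) kl /k.
    case: (j =P idx F) => [->|ne]; first by rewrite eqSS gtn_eqF.
    by rewrite ltnSn eqSS; split=> //; apply/eqP/nesym.
  have [s [sF sp sl]] := IH k Fk kF'; exists (rcons s (coset_face i' (x * (h * C j))%g)).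
  rewrite all_rcons rcons_path last_rcons sF sp sl andbT /=.
  have gd y : gen C (fun j => (idx F <= j) && (j.+1 < idx F')) y ->
      cset F (x * y)%g /\ cset F' (x * y)%g.
    move=> gy; rewrite (coset_face_eq Fx) (coset_face_eq F'x) /= /coset /= mulKg; split.
      by apply: gen_sub gy => l /andP[Fl _] _; rewrite gtn_eqF.
    by apply: gen_sub gy => l /andP[_ Fl] _; rewrite ltn_eqF.
  have [F1 F2] := gd (h * C j)%g (genM gh (introT andP (conj Fj jF'))).
  split=> //; first by rewrite coset_face_between.
  have in1 : cset (coset_face k (x * h)%g) (x * (h * C j))%g.
    by rewrite /= /coset /= (mulgA x h) mulKg; apply: stab_rho; rewrite eq_sym.
  exact: comparable_common in1 (in_coset_face _ _).
Qed.

Lemma polytope_connected (F F' : cface) : (F <= F')%O -> section_connected rankf F F'.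
Proof.
move=> FF'; have [l|l] := leqP (idx F') (idx F + 2).
  by left; rewrite /rankf; lia.
right=> M N /andP[FM MF'] /andP[FN NF'].
have cm L : (F < L)%O -> (L < F')%O -> exists x, [/\ cset F x, cset L x & cset F' x].
  move=> FL LF'; have [y ymem] : exists y, forall K, [set F; L; F'] K -> cset K y.
    apply: chain_common => A B /= [[->|->]|->] [[->|->]|->];
      rewrite ?lexx ?(ltW FL) ?(ltW LF') ?FF' //; by [left|right].
  by exists y; split; apply: ymem; [left; left|left; right|right].
have [x [Fx Mx F'x]] := cm M FM MF'; have [y [Fy Ny F'y]] := cm N FN NF'.
have st1 : stab (idx F) (x^-1 * y)%g by move: Fy; rewrite (coset_face_eq Fx).
have st2 : stab (idx F') (x^-1 * y)%g by move: F'y; rewrite (coset_face_eq F'x).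
have l3 : idx F + 3 <= idx F' by rewrite addnS.
have l4 : idx F' <= 4 by rewrite -ltnS.
have gs := stab_section l3 l4 st1 st2.
have [s] := section_path l3 Fx F'x gs (cface_lt_idx FM) (cface_lt_idx MF') (cface_lt_idx FN) (cface_lt_idx NF').
by rewrite mulVKg -(coset_face_eq Mx) -(coset_face_eq Ny); exists s.
Qed.

Lemma rankf_least : rankf \bot%O = (- 1)%R. Proof. by []. Qed.
Lemma rankf_greatest : rankf \top%O = 3%:Z%R. Proof. by []. Qed.

Definition coset_polyhedron : polytope 3 :=
  @Polytope 3 cface_le_display cface rankf rankf_lt rankf_covers rankf_least
    rankf_greatest card_flag card_middle polytope_connected.

End CosetPolytope.

Arguments flagset {G} C x _.

(** * Automorphisms, duality and type of the coset polyhedron *)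

Section Translations.

Variables (G : groupType) (C : string_Cgroup G).
Implicit Types (x y z g h a b : G) (F : cface C).

Let rhoK := @rho_sq G C.
Local Notation P := (coset_polyhedron C).

Lemma translated_coset a F :
  exists h, [set x | cset F (a^-1 * x)%g] = coset C (idx F) h.
Proof.
case: F => [i A [h /= ->]]; exists (a * h)%g.
by apply/seteqP; split=> x; rewrite /coset /= invgM mulgA.
Qed.

Definition translate a F : cface C := CFace (translated_coset a F).

Lemma translate_coset_face a i x : translate a (coset_face C i x) = coset_face C i (a * x)%g.
Proof.
by apply: cface_eq => //; apply/seteqP; split=> y; rewrite /= /coset /= invgM mulgA.
Qed.

Lemma faceP F : exists i x, F = coset_face C i x.
Proof. by have [x Fx] := cset_nonempty F; exists (idx F), x; apply: coset_face_eq. Qed.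

Lemma translate_mul a b F : translate a (translate b F) = translate (a * b)%g F.
Proof. by have [i [x ->]] := faceP F; rewrite !translate_coset_face mulgA. Qed.

Lemma translate1 F : translate 1%g F = F.
Proof. by have [i [x ->]] := faceP F; rewrite translate_coset_face mul1g. Qed.

Lemma translateK a : cancel (translate a) (translate a^-1%g).
Proof. by move=> F; rewrite translate_mul mulVg translate1. Qed.

Lemma translate_in a F x : cset F x -> cset (translate a F) (a * x)%g.
Proof. by rewrite /= mulKg. Qed.

Lemma translate_le a F F' : (F <= F')%O -> (translate a F <= translate a F')%O.
Proof.
rewrite cface_leE => /cface_leP[l [x [x1 x2]]].
apply: (@cface_le_common _ _ (translate a F) (translate a F') (a * x)%g) => //;
  exact: translate_in.
Qed.

Lemma translate_automorphism a : @automorphism 3 P (translate a).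
Proof.
have K' : cancel (translate a^-1%g) (translate a) by rewrite -{2}[a]invgK; apply: translateK.
split; first exact: Bijective (translateK a) K'.
move=> F F'; apply/idP/idP; last exact: translate_le.
by move/(translate_le a^-1%g); rewrite !translateK.
Qed.

Lemma translate_flag a x : translate a @` flagset C x = flagset C (a * x)%g.
Proof.
apply/seteqP; split=> [_ [F Fx <-]|F Fx]; first exact: translate_in.
exists (translate a^-1%g F); last by rewrite translate_mul mulgV translate1.
by rewrite /flagset /= invgK.
Qed.

Lemma flagset_inj : injective (fun x => flagset C x).
Proof. by move=> x y /seteqP[s _]; apply: flagset_eq s. Qed.

Lemma translate_inj a b : translate a =1 translate b -> a = b.
Proof.
move=> /funext e; rewrite -[a]mulg1 -[b]mulg1; apply: flagset_inj.
by rewrite -!translate_flag e.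
Qed.

Lemma regular_coset_polyhedron : regular P.
Proof.
move=> _ _ /maximal_chainP[x ->] /maximal_chainP[y ->].
exists (translate (y * x^-1)%g); first exact: translate_automorphism.
by rewrite translate_flag mulgVK.
Qed.

Lemma automorphism_lt (f : P -> P) : @automorphism 3 P f ->
  forall F F' : cface C, (F < F')%O -> (f F < f F')%O.
Proof.
move=> [[f' fK _] monof] F F'; rewrite !lt_neqAle !monof => /andP[n ->].
by rewrite (can_eq fK) n.
Qed.

Lemma coset_face_lt (i j : 'I_5) x : i < j -> (coset_face C i x < coset_face C j x)%O.
Proof. by move=> l; apply: (@cface_lt_common _ _ _ _ x) => //; apply: in_coset_face. Qed.

(** An automorphism maps the five faces of a flag to an increasing sequence
    of five faces, so it preserves ranks. *)
Lemma automorphism_idx (f : P -> P) (F : cface C) :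
  @automorphism 3 P f -> idx (f F : cface C) = idx F.
Proof.
move=> autf; have [i [x ->]] := faceP F => /=.
pose e k := idx (f (coset_face C (inord k) x : P) : cface C) : nat.
have lt_e k : k < 4 -> e k < e k.+1.
  move=> k4; apply/cface_lt_idx/automorphism_lt => //; apply: coset_face_lt.
  by rewrite !inordK// ltnW.
have [[[e0 e1] e2] e3] := (lt_e 0 isT, lt_e 1 isT, lt_e 2 isT, lt_e 3 isT).
have e4 : e 4 < 5 by apply: ltn_ord.
have ek k : k < 5 -> e k = k.
  by case: k => [|[|[|[|[|k]]]]] _ //; lia.
by apply: val_inj; rewrite /= -[RHS]ek // /e inord_val.
Qed.

(** After a translation the automorphism fixes the base flag; by the diamond
    condition it then fixes all adjacent flags, and the group acts
    transitively on flags through adjacent ones. *)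
Lemma automorphism_translate (f : P -> P) :
  @automorphism 3 P f -> exists a, f =1 translate a.
Proof.
move=> autf.
have [y ymem] : exists y, forall F, (f @` flagset C 1%g) F -> cset F y.
  apply: chain_common => _ _ [F F1 <-] [F' F'1 <-].
  rewrite !(proj2 autf); apply/orP; exact: comparable_common F1 F'1.
have fmk i : f (coset_face C i 1%g) = coset_face C i y.
  rewrite [LHS](@coset_face_eq _ _ _ y) ?automorphism_idx//.
  by apply: ymem; exists (coset_face C i 1%g) => //; apply: in_coset_face.
exists y => F; pose f' := translate y^-1%g \o f.
have autf' : @automorphism 3 P f'.
  have [bt mt] := translate_automorphism y^-1%g.
  split; first by apply: bij_comp => //; case: autf.
  by move=> F1 F2; rewrite /f' /= mt (proj2 autf).
suff: forall h i, f' (coset_face C i h) = coset_face C i h.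
  have [i [h ->]] := faceP F => /(_ h i); rewrite /f' /= => E.
  by rewrite -[in RHS]E translate_mul mulgV translate1.
move=> h; elim: (rho_gen C h) => [|{}h j _ IH _] i.
  by rewrite /f' /= fmk translate_coset_face mulVg.
have [j3|j3] := leqP 3 j; first by rewrite (rho_ge3 C j3) mulg1.
have same (k : 'I_5) : k != j.+1 :> nat -> coset_face C k (h * C j)%g = coset_face C k h.
  move=> kj; apply: (@same_idx _ _ _ _ (h * C j)%g) => //; first exact: in_coset_face.
  by rewrite /= /coset /= mulKg; apply: stab_rho; rewrite eq_sym.
have [ij|ij] := eqVneq (i : nat) j.+1; last by rewrite same.
have ej : (inord j : 'I_5) = j :> nat by rewrite inordK// ltnW// ltnW.
have ej2 : (inord j.+2 : 'I_5) = j.+2 :> nat by rewrite inordK.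
have ei : i = inord (idx (coset_face C (inord j) h)).+1.
  by apply: val_inj; rewrite /= ej inordK// ltnW.
pose D := coset_face C (inord j) h; pose U := coset_face C (inord j.+2) h.
have mid := @middle_faces _ C D U _ h.
have eDU : idx U = (idx D).+2 :> nat by rewrite /= ej ej2.
have Dh : cset D h := in_coset_face _ _ _; have Uh : cset U h := in_coset_face _ _ _.
have fD : f' D = D by apply: IH.
have fU : f' U = U by apply: IH.
have := mid (coset_face C i (h * C j)%g) eDU Dh Uh; rewrite -ei /= ej => -[_ /(_ (or_intror erefl))].
case=> eN /andP[DN NU]; have := mid (f' (coset_face C i (h * C j)%g)) eDU Dh Uh.
rewrite -ei /= ej => -[+ _]; case.
- rewrite automorphism_idx//; split=> //; apply/andP; split.
    by rewrite -fD; apply: (automorphism_lt autf').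
  by rewrite -fU; apply: (automorphism_lt autf').
- move=> E; have /(bij_inj (proj1 autf')) : f' (coset_face C i (h * C j)%g) = f' (coset_face C i h).
    by rewrite E IH.
  by move=> ->; apply: IH.
- by [].
Qed.

Lemma adjacent_flagP (i : nat) x (Psi : set (cface C)) : i < 3 ->
  @adjacent_flag 3 P i (flagset C x) Psi <-> Psi = flagset C (x * C i)%g.
Proof.
move=> i3; split=> [[/maximal_chainP[y ->] neq same]|->].
  congr flagset; have st (r : 'I_5) : r != i.+1 :> nat -> stab C r (x^-1 * y)%g.
    move=> ri; have : flagset C y (coset_face C r x).
      apply/(same (coset_face C r x : P)); last exact: in_coset_face.
      by rewrite /= /rankf /= => e; move/eqP: ri; lia.
    by [].
  have st' r : r < 5 -> r != i.+1 -> stab C r (x^-1 * y)%g.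
    by move=> r5 ri; have := st (inord r); rewrite inordK//; apply.
  have [s|s] := stab_middle i3 (st' i (ltn_trans i3 (isT : 3 < 5)) (negbT (ltn_eqF (ltnSn _))))
      (st' i.+2 i3 (negbT (gtn_eqF (ltnSn _)))).
    case: neq; congr flagset; apply/esym/(@mulgI _ x^-1%g); rewrite mulVg; apply/esym.
    by apply: (@stab_all _ C);
      [have [e|e] := eqVneq 1 i.+1|have [e|e] := eqVneq 2 i.+1|have [e|e] := eqVneq 3 i.+1];
      rewrite ?e//; apply: st'.
  have st3 r : r < 5 -> stab C r (C i * (x^-1 * y))%g.
    move=> r5; have [->//|ri] := eqVneq r i.+1.
    by apply: stabM; [apply: stab_rho; rewrite eq_sym|apply: st'].
  have : (C i * (x^-1 * y) = 1)%g by apply: (@stab_all _ C); apply: st3.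
  move/mulg1_eq; rewrite (rhoV rhoK) => ->.
  by rewrite mulVKg.
split.
- by apply/maximal_chainP; exists (x * C i)%g.
- move=> /flagset_inj/(canRL (mulKg x)); rewrite mulVg.
  exact: rho_neq1.
move=> F rF; have ri : i.+1 != idx F :> nat.
  by apply/eqP => e; apply: rF; rewrite /= /rankf -e; lia.
rewrite /flagset /=; split=> m.
  have -> : (x = (x * C i) * C i)%g by rewrite -mulgA rhoK mulg1.
  by rewrite (coset_face_eq m) /= /coset /= mulKg; apply: stab_rho.
by rewrite (coset_face_eq m) /= /coset /= mulKg; apply: stab_rho.
Qed.

Lemma distinguished_translate x (tau : nat -> P -> P) :
  distinguished_generators (flagset C x : set P) tau <->
  forall i, i < 3 -> tau i =1 translate (x * C i * x^-1)%g.
Proof.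
split=> [dg i i3|tauE i i3].
  have [/automorphism_translate[a ta] /(adjacent_flagP _ _ i3)] := dg i i3.
  rewrite (funext ta : tau i = translate a) translate_flag => /flagset_inj e F.
  by rewrite -e mulgK.
rewrite (funext (tauE i i3) : tau i = translate _); split; first exact: translate_automorphism.
by apply/(adjacent_flagP _ _ i3); rewrite translate_flag mulgVK.
Qed.

Lemma has_dualizingP : has_dualizing P <->
  exists a, forall i, i < 3 -> (a * C i = C (2 - i) * a)%g.
Proof.
split=> [[_ /maximal_chainP[x ->] [alpha [/automorphism_translate[a aE] [tau dg tauE]]]]|[a aE]].
  exists (x^-1 * a * x)%g => i i3; have i3' : 2 - i < 3 by rewrite ltnS leq_subr.
  move/distinguished_translate: dg => dg.
  have E : (x * C (2 - i) * x^-1 * a = a * (x * C i * x^-1))%g.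
    apply: translate_inj => F; rewrite -(translate_mul _ a) -(translate_mul a) -!aE.
    rewrite -(dg _ i3') -(dg _ i3) -[in RHS](_ : 3 - (2 - i) - 1 = i)%N; last by lia.
    exact: tauE _ i3' F.
  have -> : (x^-1 * a * x * C i = x^-1 * (a * (x * C i * x^-1)) * x)%g by rewrite !gnorm.
  by rewrite -E !gnorm.
exists (flagset C 1%g); first by apply/maximal_chainP; exists 1%g.
exists (translate a); split; first exact: translate_automorphism.
exists (fun i => translate (C i)).
  by apply/distinguished_translate => i i3 F; rewrite mul1g invg1 mulg1.
move=> i i3 F; rewrite /= !translate_mul; congr (translate _ F).
by rewrite subnAC aE ?subKn// ltnS leq_subr.
Qed.

Lemma iter_translate a n F : iter n (translate a) F = translate (a ^+ n)%g F.
Proof. by elim: n => [|n IH]; rewrite ?translate1 // expgS /= IH translate_mul. Qed.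

(** Divisibility by 0 encodes infinite order, because 0 only divides 0; this
    treats finite and infinite types at once. *)
Definition group_order g (p : option nat) := forall n, (g ^+ n = 1)%g <-> odflt 0 p %| n.

Lemma has_order_translate a p : p <> Some 0 -> group_order a p -> has_order (translate a) p.
Proof.
move=> p0 op; have iter_id n : iter n (translate a) =1 id <-> odflt 0 p %| n.
  split=> [e|/op e F]; last by rewrite iter_translate e translate1.
  by apply/op/translate_inj => F; rewrite -iter_translate e translate1.
case: p p0 {op} iter_id => [k|] /= p0 ord.
  have k0 : 0 < k by rewrite lt0n; apply/eqP => k0; apply: p0; rewrite k0.
  split=> //; first exact/ord.
  move=> m /andP[m0 coset_face] /ord/(dvdn_leq m0).
  by rewrite leqNgt coset_face.
by move=> m m0 /ord; rewrite dvd0n -leqn0 leqNgt m0.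
Qed.

Lemma group_orderV a p : group_order a p -> group_order a^-1%g p.
Proof.
move=> op n; rewrite expVgn -(op n); split=> [e|->]; last exact: invg1.
by rewrite -[LHS]invgK e invg1.
Qed.

Lemma has_type_coset_polyhedron p : p <> Some 0 ->
  group_order (C 0 * C 1%N)%g p -> group_order (C 1%N * C 2)%g p -> has_type P p p.
Proof.
move=> p0 o01 o12; exists (flagset C 1%g); first by apply/maximal_chainP; exists 1%g.
exists (fun i => translate (C i)).
  by apply/distinguished_translate => i i3 F; rewrite mul1g invg1 mulg1.
have comp i j : translate (C i) \; translate (C j) = translate (C i * C j)^-1%g.
  by apply/funext => F; rewrite /= translate_mul invgM !(rhoV rhoK).
by rewrite !comp; split; apply: has_order_translate => //; apply: group_orderV.
Qed.

(** The duality sends a coset to its image under theta, which is involutive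
    and therefore also a preimage. *)
Lemma self_dual_coset_polyhedron (theta : G -> G) :
  (forall x y, theta (x * y) = theta x * theta y)%g -> involutive theta ->
  (forall i, i < 3 -> theta (C i) = C (2 - i)) -> self_dual P.
Proof.
move=> thM thK thC; have th1 : theta 1%g = 1%g.
  by apply: (@mulgI _ (theta 1%g)); rewrite -thM !mulg1.
have thV x : theta x^-1%g = (theta x)^-1%g.
  by apply/esym/mulg1_eq; rewrite -thM mulgV.
have th_stab r x : r < 5 -> stab C r x -> stab C (4 - r) (theta x).
  move=> r5; elim=> [|y j _ IH jr]; first by rewrite th1; apply: stab1.
  rewrite thM; apply: stabM => //.
  have [j3|j3] := leqP 3 j; first by rewrite (rho_ge3 C j3) th1; apply: stab1.
  by rewrite (thC _ j3); apply: stab_rho; apply/eqP; move/eqP: jr; lia.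
have dual_coset F : exists h, [set x | cset F (theta x)] = coset C (rev_ord (idx F)) h.
  case: F => [i A [h /= ->]]; exists (theta h); apply/seteqP; split=> x; rewrite /coset /= => hx.
    by have := th_stab _ _ (ltn_ord i) hx; rewrite thM thV thK.
  have := th_stab _ _ (ltn_ord (rev_ord i)) hx; rewrite thM thV thK /=.
  by rewrite subKn // -ltnS.
pose D (F : cface C) : cface C := CFace (dual_coset F).
have D_inv : involutive D.
  move=> F; apply: cface_eq; first exact: rev_ordK.
  by apply/seteqP; split=> x; rewrite /= thK.
exists D; split; first exact: inv_bij D_inv.
suff anti F F' : (F <= F')%O -> (D F' <= D F)%O.
  by move=> F F'; apply/idP/idP => [/anti|]; [rewrite !D_inv|apply: anti].
rewrite cface_leE => /cface_leP[l [x [x1 x2]]].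
apply: (@cface_le_common _ _ (D F') (D F) (theta x)); rewrite /= ?thK //.
by rewrite leq_sub2l.
Qed.

Lemma finite_coset_polyhedron : finite_set [set: G] -> finite_set [set: P].
Proof.
move=> finG; apply: (@sub_finite_set _ _ [set coset_face C i x | i in [set: 'I_5] & x in [set: G]]).
  by move=> F _; have [i [x ->]] := faceP F; exists i => //; exists x.
apply: finite_image2 => //.
Qed.

Lemma many_faces (m : nat) (x : nat -> G) :
  (forall j k, j < m -> k < m -> stab C 3 ((x j)^-1 * x k)%g -> j = k) ->
  `I_m #<= [set: P].
Proof.
move=> inj; have : (fun j => coset_face C (inord 3) (x j)) @` `I_m #= `I_m.
  apply: inj_card_eq => j k; rewrite !inE /= => jm km /(congr1 (@cset G C)) /= e.
  apply: inj => //; have := coset_id C 3 (x k).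
  by move: e; rewrite inordK // => <-.
rewrite card_eq_le => /andP[_ le_m].
exact: card_le_trans le_m (card_leT _).
Qed.

End Translations.

(** * Self-dual polyhedra obtained by halving *)

(** The group generated by hr0, hr1, hr2 is a quotient of the Coxeter group
    [4,p], where p is the order of hr1 * hr2, with hr0 moving the base vertex
    of the corresponding map; the halved polyhedron uses hr1, hr2 and the
    conjugate of hr1 by hr0. *)
Record halving (G : groupType) := Halving {
  hr0 : G;
  hr1 : G;
  hr2 : G;
  hr0K : (hr0 * hr0 = 1)%g;
  hr1K : (hr1 * hr1 = 1)%g;
  hr2K : (hr2 * hr2 = 1)%g;
  hr02C : commute hr0 hr2;
  hr101C : commute hr1 (hr0 * hr1 * hr0)%g }.

Section Halving.

Variables (G : groupType) (h : halving G).
Implicit Types (x y z a : G) (j : nat).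
Local Notation r0 := (hr0 h).
Local Notation r1 := (hr1 h).
Local Notation r2 := (hr2 h).

Definition hgen j : G := nth 1%g [:: r1; r2; r0 * r1 * r0]%g j.

Lemma hgenK j : (hgen j * hgen j = 1)%g.
Proof.
case: j => [|[|[|j]]]; rewrite /hgen /= ?hr1K ?hr2K ?nth_nil ?mulg1//.
by rewrite -!mulgA (mulgA r0 r0) hr0K mul1g (mulgA r1 r1) hr1K mul1g hr0K.
Qed.

Definition halved := gen hgen predT.
(** The stabiliser of the base 2-face of the halved polyhedron. *)
Definition dihedral := gen hgen (fun j => j < 2).

Lemma conj_hr0M x y : (r0 * (x * y) * r0 = (r0 * x * r0) * (r0 * y * r0))%g.
Proof. by rewrite -!mulgA (mulgA r0 r0) hr0K mul1g. Qed.

Lemma conj_hr0K x : (r0 * (r0 * x * r0) * r0 = x)%g.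
Proof. by rewrite -!mulgA hr0K mulg1 mulgA hr0K mul1g. Qed.

Lemma conj_hgen j : j < 3 -> (r0 * hgen j * r0 = hgen (2 - j))%g.
Proof.
case: j => [|[|[|]]]//= _; last exact: conj_hr0K.
by rewrite /hgen /= (hr02C h) -mulgA hr0K mulg1.
Qed.

Lemma gen_conj (J J' : pred nat) x : (forall j, j < 3 -> J j -> J' (2 - j)) ->
  gen hgen J x -> gen hgen J' (r0 * x * r0)%g.
Proof.
move=> JJ'; elim=> [|y j _ IH Jj]; first by rewrite mulg1 hr0K; apply: gen1.
have [j3|j3] := leqP 3 j; first by rewrite /hgen nth_default// mulg1.
by rewrite conj_hr0M conj_hgen//; apply: gen_mul => //; apply/gen_gen/JJ'.
Qed.

Lemma halvedJ x : halved x -> halved (r0 * x * r0)%g.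
Proof. exact: gen_conj. Qed.

Lemma halvedM x y : halved x -> halved y -> halved (x * y)%g.
Proof. exact: gen_mul. Qed.

Lemma halvedV x : halved x -> halved x^-1%g.
Proof. exact: gen_inv hgenK _ _. Qed.

Lemma halvedX x n : halved x -> halved (x ^+ n)%g.
Proof.
by move=> Hx; elim: n => [|n IH]; [apply: gen1|rewrite expgS; apply: halvedM].
Qed.

Lemma dihedral_halved x : dihedral x -> halved x. Proof. exact: gen_sub. Qed.

Lemma dihedral_hr1 : dihedral r1. Proof. exact: (@gen_gen _ hgen _ 0). Qed.
Lemma dihedral_hr2 : dihedral r2. Proof. exact: (@gen_gen _ hgen _ 1). Qed.
Lemma dihedralM x y : dihedral x -> dihedral y -> dihedral (x * y)%g.
Proof. exact: gen_mul. Qed.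

(** The even powers of t lie in the halved group, since hr0 normalizes it,
    and t is one of them when its order is odd. *)
Lemma odd_relation t n : odd n -> (t ^+ n = 1)%g -> halved (r0 * t)%g -> halved r0.
Proof.
move=> n_odd tn Ht; have Ht2 : halved (t * t)%g.
  have -> : (t * t = (r0 * (r0 * t) * r0) * (r0 * t))%g.
    by rewrite (mulgA r0 r0) hr0K mul1g -mulgA (mulgA r0 r0) hr0K mul1g.
  by apply: halvedM => //; apply: halvedJ.
have tE : t = ((t * t) ^+ (n./2.+1))%g.
  have -> : (t * t = t ^+ 2)%g by [].
  rewrite -expgnA (_ : 2 * n./2.+1 = n.+1).
    by rewrite expgSr tn mul1g.
  by have := odd_double_half n; rewrite n_odd; lia.
have Htt : halved t by rewrite tE; apply: halvedX.
by rewrite -[r0](mulgK t); apply: halvedM => //; apply: halvedV.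
Qed.

Definition halved_pred : pred G := fun x => `[< halved x >].

Lemma halved_closed : group_closed halved_pred.
Proof.
split; first by apply/asboolP/gen1.
by move=> x y /asboolP Hx /asboolP Hy; apply/asboolP/halvedM/halvedV.
Qed.

Definition halved_group := {x : G | halved_pred x}.

HB.instance Definition _ := Choice.on halved_group.
HB.instance Definition _ := SubChoice.on halved_group.
HB.instance Definition _ := SubChoice_isSubGroup.Build G halved_pred halved_group halved_closed.

Lemma halved_hgen j : halved_pred (hgen j).
Proof. exact/asboolP/gen_gen. Qed.

Definition hsub_gen j : halved_group := Sub (hgen j) (halved_hgen j).

Lemma val_hsub_gen j : val (hsub_gen j) = hgen j. Proof. exact: SubK. Qed.

Lemma val_halvedM (x y : halved_group) : val (x * y)%g = (val x * val y)%g.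
Proof. exact: gmulfM. Qed.

Lemma val_halved1 : val (1%g : halved_group) = 1%g.
Proof. exact: gmulf1. Qed.

Lemma gen_val (J : pred nat) (x : halved_group) :
  gen hsub_gen J x <-> gen hgen J (val x).
Proof.
split=> [|gx].
  by elim=> [|y j _ IH Jj]; [rewrite val_halved1; apply: gen1|rewrite val_halvedM val_hsub_gen; apply: genM].
have lift v : gen hgen J v -> exists2 y : halved_group, val y = v & gen hsub_gen J y.
  elim=> [|_ j _ [z <- gz] Jj]; first by exists 1%g; [apply: val_halved1|apply: gen1].
  by exists (z * hsub_gen j)%g; [rewrite val_halvedM val_hsub_gen|apply: genM].
by have [y /val_inj <-] := lift _ gx.
Qed.

Lemma hsub_genK j : (hsub_gen j * hsub_gen j = 1)%g.
Proof. by apply: val_inj; rewrite val_halvedM val_hsub_gen val_halved1 hgenK. Qed.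

Lemma hsub_gen_full (x : halved_group) : gen hsub_gen predT x.
Proof. by apply/gen_val; apply/asboolP; apply: (valP x). Qed.

End Halving.

(** Conjugating by hr0, the last condition is the intersection property of
    the generators hr1, hr2 and hr0 * hr1 * hr0. *)
Record polytopal (G : groupType) (h : halving G) : Prop := Polytopal {
  hr1_neq1 : hr1 h <> 1%g;
  hr2_neq1 : hr2 h <> 1%g;
  hr12_neq : hr1 h <> hr2 h;
  dihedral_meet : forall x, dihedral h x -> dihedral h (hr0 h * x * hr0 h)%g ->
    x = 1%g \/ x = hr2 h }.

Section HalvedPolyhedron.

Variables (G : groupType) (h : halving G) (hP : polytopal h).
Local Notation r0 := (hr0 h).
Local Notation r1 := (hr1 h).
Local Notation r2 := (hr2 h).
Local Notation g := (hsub_gen h).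

Lemma hsub_gen_ge3 j : 3 <= j -> g j = 1%g.
Proof. by case: j => [|[|[|j]]]// _; apply: val_inj; rewrite val_hsub_gen /hgen /= nth_nil. Qed.

Lemma hsub_gen_comm : commute (g 0) (g 2).
Proof. by apply: val_inj; rewrite !val_halvedM !val_hsub_gen; apply: hr101C. Qed.

Lemma conj_hr0_eq x y : (r0 * x * r0 = r0 * y * r0)%g -> x = y.
Proof. by move/mulIg/mulgI. Qed.

Lemma conj_hr0_1 : (r0 * 1 * r0 = 1)%g.
Proof. by rewrite mulg1 hr0K. Qed.

Lemma conj_hr02 : (r0 * r2 * r0 = r2)%g. Proof. exact: (@conj_hgen _ h 1). Qed.

Lemma hsub_gen_eq i j : g i = g j -> hgen h i = hgen h j.
Proof. by move/(congr1 val); rewrite !val_hsub_gen. Qed.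

Lemma hsub_gen_neq1 j : j < 3 -> g j <> 1%g.
Proof.
move=> j3 /(congr1 val); rewrite val_hsub_gen val_halved1.
case: j j3 => [|[|[|]]]//= _; [exact: hr1_neq1|exact: hr2_neq1|].
by rewrite /hgen /= -conj_hr0_1 => /conj_hr0_eq; apply: hr1_neq1.
Qed.

Lemma hsub_gen_neq01 : g 0 <> g 1.
Proof. by move/hsub_gen_eq; apply: hr12_neq. Qed.

Lemma hsub_gen_neq21 : g 2 <> g 1.
Proof.
by move/hsub_gen_eq; rewrite /hgen /= -conj_hr02 => /conj_hr0_eq; apply: hr12_neq.
Qed.

Lemma hsub_gen_meet (x : halved_group h) : gen g (fun j => j < 2) x -> gen g (fun j => 0 < j) x ->
  x = 1%g \/ x = g 1.
Proof.
move=> /gen_val g01 /gen_val g12.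
have g12' : dihedral h (r0 * val x * r0)%g.
  by apply: gen_conj g12 => j; rewrite ltnS => j2 j0; lia.
case: (dihedral_meet hP g01 g12') => e; [left|right]; apply: val_inj;
  by rewrite e ?val_hsub_gen ?val_halved1.
Qed.

Definition halved_string_Cgroup : string_Cgroup (halved_group h) :=
  StringCgroup hsub_gen_ge3 (@hsub_genK _ h) hsub_gen_comm hsub_gen_neq1 hsub_gen_neq01
    hsub_gen_neq21 (@hsub_gen_full _ h) hsub_gen_meet.

Lemma val_halved_string_Cgroup j : val (halved_string_Cgroup j) = hgen h j.
Proof. exact: val_hsub_gen. Qed.

Definition halved_polyhedron : polytope 3 := coset_polyhedron halved_string_Cgroup.

Lemma conj_halved_subproof (x : halved_group h) : halved_pred h (r0 * val x * r0)%g.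
Proof. by apply/asboolP/halvedJ/asboolP/(valP x). Qed.

Definition conj_halved (x : halved_group h) : halved_group h :=
  Sub (r0 * val x * r0)%g (conj_halved_subproof x).

Lemma val_conj_halved x : val (conj_halved x) = (r0 * val x * r0)%g.
Proof. exact: SubK. Qed.

Lemma halved_regular : regular halved_polyhedron.
Proof. exact: regular_coset_polyhedron. Qed.

Lemma halved_self_dual : self_dual halved_polyhedron.
Proof.
apply: (@self_dual_coset_polyhedron _ halved_string_Cgroup conj_halved).
- move=> x y; apply: val_inj.
  by rewrite val_halvedM !val_conj_halved val_halvedM conj_hr0M.
- by move=> x; apply: val_inj; rewrite !val_conj_halved conj_hr0K.
- move=> i i3; apply: val_inj; rewrite val_conj_halved !val_halved_string_Cgroup.
  exact: conj_hgen.
Qed.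

Lemma val_halvedX (x : halved_group h) n : val (x ^+ n)%g = (val x ^+ n)%g.
Proof. by elim: n => [|n IH]; rewrite ?val_halved1 // !expgS val_halvedM IH. Qed.

Lemma group_order_val (x : halved_group h) p :
  group_order (val x) p -> group_order x p.
Proof.
move=> ox n; rewrite -(ox n); split=> [e|e]; first by rewrite -val_halvedX e val_halved1.
by apply: val_inj; rewrite val_halvedX e val_halved1.
Qed.

Lemma halved_has_type p : p <> Some 0 -> group_order (r1 * r2)%g p ->
  has_type halved_polyhedron p p.
Proof.
move=> p0 op; apply: has_type_coset_polyhedron => //; apply: group_order_val;
  rewrite val_halvedM !val_halved_string_Cgroup //.
have -> : (hgen h 1%N * hgen h 2 = r0 * (r1 * r2)^-1 * r0)%g.
  rewrite invgM (mulg1_eq (hr1K h)) (mulg1_eq (hr2K h)) conj_hr0M.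
  by rewrite conj_hr02.
have conjX x n : ((r0 * x * r0) ^+ n = r0 * x ^+ n * r0)%g.
  by elim: n => [|n IH]; rewrite ?conj_hr0_1 // !expgS IH -conj_hr0M.
move=> n; rewrite conjX -(group_orderV op n); split=> [|->]; last exact: conj_hr0_1.
by move=> e; apply: conj_hr0_eq; rewrite e conj_hr0_1.
Qed.

Lemma halved_has_dualizingP : has_dualizing halved_polyhedron <->
  exists2 a, halved h a & forall j, j < 3 -> (a * hgen h j = hgen h (2 - j) * a)%g.
Proof.
split=> [/has_dualizingP[a aE]|[a Ha aE]].
  exists (val a); first exact/asboolP/(valP a).
  by move=> j j3; have := congr1 val (aE j j3); rewrite !val_halvedM !val_halved_string_Cgroup.
apply/has_dualizingP; have pa : halved_pred h a by apply/asboolP.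
exists (Sub a pa) => j j3; apply: val_inj.
by rewrite !val_halvedM !val_halved_string_Cgroup !SubK aE.
Qed.

Lemma halved_internal : halved h r0 -> internally_self_dual halved_polyhedron.
Proof.
move=> Hr0; split; [exact: halved_regular|exact: halved_self_dual|].
apply/halved_has_dualizingP; exists r0 => // j j3.
by rewrite -conj_hgen// -mulgA hr0K mulg1.
Qed.

Lemma halved_external :
  (forall a, halved h a -> (forall j, j < 3 -> a * hgen h j = hgen h (2 - j) * a)%g -> False) ->
  externally_self_dual halved_polyhedron.
Proof.
move=> noa; split; [exact: halved_regular|exact: halved_self_dual|].
by move=> /halved_has_dualizingP[a]; apply: noa.
Qed.

Lemma finite_halved : finite_set [set: G] -> finite_set [set: halved_polyhedron].
Proof.
move=> finG; apply: finite_coset_polyhedron.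
have inj : {in [set: halved_group h] &, injective val} by move=> x y _ _; apply: val_inj.
have := inj_card_eq inj; rewrite card_eq_le => /andP[_ le].
exact: card_le_finite le (sub_finite_set (@subsetT _ _) finG).
Qed.

Lemma halved_many_faces m (x : nat -> G) : (forall j, j < m -> halved h (x j)) ->
  (forall j k, j < m -> k < m -> dihedral h ((x j)^-1 * x k)%g -> j = k) ->
  `I_m #<= [set: halved_polyhedron].
Proof.
move=> Hx inj.
have [y yE] : exists y : nat -> halved_group h, forall j, j < m -> val (y j) = x j.
  exists (fun j => insubd 1%g (x j)) => j jm.
  by rewrite insubdK //; apply/asboolP/Hx.
apply: (@many_faces _ halved_string_Cgroup _ y) => j k jm km /gen_val st.
apply: inj => //; have valV : val (y j)^-1%g = (val (y j))^-1%g.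
  by apply/esym/mulg1_eq; rewrite -val_halvedM mulgV val_halved1.
rewrite -!yE // -valV -val_halvedM.
by apply: gen_sub st => -[|[|[|i]]] //= _; rewrite /hgen /= nth_nil.
Qed.

End HalvedPolyhedron.

(** * Permutations of a type *)

Section Sym.

Variable S : Type.

(** Carrying the inverse makes this a group for every type, finite or not;
    products compose from right to left. *)
Record sym := Sym {
  sym_fun :> S -> S;
  sym_inv : S -> S;
  _ : cancel sym_fun sym_inv;
  _ : cancel sym_inv sym_fun }.

Lemma symP (f g : sym) : f =1 g -> f = g.
Proof.
case: f g => [f f' fK f'K] [g g' gK g'K] /= /funext e; subst g.
have e' : f' = g' by apply/funext => x; rewrite -{1}[x]g'K fK.
by subst g'; congr Sym; apply: Prop_irrelevance.
Qed.

Lemma sym_funK (f : sym) : cancel f (sym_inv f). Proof. by case: f. Qed.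
Lemma sym_invK (f : sym) : cancel (sym_inv f) f. Proof. by case: f. Qed.

Definition sym_one : sym := @Sym id id (fun=> erefl) (fun=> erefl).
Definition sym_mul (f g : sym) : sym :=
  Sym (can_comp (sym_funK f) (sym_funK g)) (can_comp (sym_invK g) (sym_invK f)).
Definition sym_invg (f : sym) : sym := Sym (sym_invK f) (sym_funK f).

HB.instance Definition _ := gen_eqMixin sym.
HB.instance Definition _ := gen_choiceMixin sym.

Fact sym_mulA : associative sym_mul. Proof. by move=> f g h; apply: symP. Qed.
Fact sym_mul1 : left_id sym_one sym_mul. Proof. by move=> f; apply: symP. Qed.
Fact sym_mulr1 : right_id sym_one sym_mul. Proof. by move=> f; apply: symP. Qed.
Fact sym_mulV : left_inverse sym_one sym_invg sym_mul.
Proof. by move=> f; apply: symP => x; apply: sym_funK. Qed.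
Fact sym_mulrV : right_inverse sym_one sym_invg sym_mul.
Proof. by move=> f; apply: symP => x; apply: sym_invK. Qed.

HB.instance Definition _ := isGroup.Build sym sym_mulA sym_mul1 sym_mulr1 sym_mulV sym_mulrV.

Lemma symM (f g : sym) x : (f * g)%g x = f (g x). Proof. by []. Qed.
Lemma sym1 x : (1%g : sym) x = x. Proof. by []. Qed.

Lemma symX (f : sym) n x : (f ^+ n)%g x = iter n f x.
Proof. by elim: n x => [|n IH] x //; rewrite expgS symM IH. Qed.

Lemma sym_inj (f : sym) : injective f.
Proof. exact: can_inj (sym_funK f). Qed.

Definition sym_involution f (fK : involutive f) : sym := Sym fK fK.

Lemma sym_involutionK f (fK : involutive f) :
  (sym_involution fK * sym_involution fK = 1)%g.
Proof. exact: symP. Qed.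

End Sym.

Lemma finite_sym (S : finType) : finite_set [set: sym S].
Proof.
have inj : {in [set: sym S] &, injective (fun f : sym S => [ffun x => f x])}.
  by move=> f g _ _ /ffunP e; apply: symP => x; have := e x; rewrite !ffunE.
have := inj_card_eq inj; rewrite card_eq_le => /andP[_ le].
exact: card_le_finite le _.
Qed.

(** * External self-duality by doubling *)

Section Doubling.

Local Notation V4 := (bool * bool)%type.

Definition swap_block (v : V4) : V4 := (~~ v.1, v.2).
Definition flip_block (v : V4) : V4 := (v.1, v.1 (+) v.2).

Lemma swap_blockK : involutive swap_block. Proof. by case=> -[] []. Qed.
Lemma flip_blockK : involutive flip_block. Proof. by case=> -[] []. Qed.

Let q0 := sym_involution swap_blockK.
Let q1 := sym_involution flip_blockK.

Variables (G : groupType) (h : halving G).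

Lemma doubled_r0K : ((hr0 h, q0) * (hr0 h, q0) = 1 :> (G * sym V4))%g.
Proof. by congr (_, _); [apply: hr0K|apply: sym_involutionK]. Qed.
Lemma doubled_r1_sq : ((hr1 h, q1) * (hr1 h, q1) = 1 :> (G * sym V4))%g.
Proof. by congr (_, _); [apply: hr1K|apply: sym_involutionK]. Qed.
Lemma doubled_r2K : ((hr2 h, 1) * (hr2 h, 1) = 1 :> (G * sym V4))%g.
Proof. by congr (_, _); [apply: hr2K|apply: mulg1]. Qed.
Lemma doubled_r02C : commute ((hr0 h, q0) : G * sym V4) (hr2 h, 1)%g.
Proof. by congr (_, _); [apply: hr02C|apply: commute1]. Qed.
Lemma doubled_r101C : commute ((hr1 h, q1) : G * sym V4)
  ((hr0 h, q0) * (hr1 h, q1) * (hr0 h, q0))%g.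
Proof. by congr (_, _); [apply: hr101C|apply: symP; case=> -[] []]. Qed.

(** The second factor has two blocks of two points: hr0 exchanges the blocks,
    hr1 flips the block with first coordinate true, so its conjugate by hr0
    flips the other one, and hr2 acts trivially. *)
Definition doubled := Halving doubled_r0K doubled_r1_sq doubled_r2K doubled_r02C doubled_r101C.

Lemma doubled_fst j : (hgen doubled j).1 = hgen h j.
Proof. by case: j => [|[|[|j]]]; rewrite /hgen /= ?nth_nil. Qed.

Lemma gen_doubled_fst J x : gen (hgen doubled) J x -> gen (hgen h) J x.1.
Proof.
by elim=> [|y j _ IH Jj]; [apply: gen1|rewrite /= doubled_fst; apply: genM].
Qed.

Lemma gen_doubled_lift J x : gen (hgen h) J x -> exists q, gen (hgen doubled) J (x, q).
Proof.
elim=> [|y j _ [q IH] Jj]; first by exists 1%g; apply: gen1.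
exists (q * (hgen doubled j).2)%g; have := genM IH Jj.
by congr gen; congr (_, _); rewrite /= doubled_fst.
Qed.

(** Every element of the halved group preserves both blocks, whereas a
    dualizing one would conjugate the flip of one block to the flip of the
    other. *)
Lemma doubled_external (dP : polytopal doubled) : externally_self_dual (halved_polyhedron dP).
Proof.
apply: halved_external => a Ha /(_ 0 isT)/(congr1 (fun x => x.2)) /= e.
have blocks : forall b c, (a.2 (b, c)).1 = b.
  elim: Ha => //= y j _ IH _ b c.
  by case: j => [|[|[|j]]]; rewrite /hgen /= ?nth_nil; case: b c => [] []; rewrite /= IH.
have := congr1 (fun f : sym V4 => f (false, false)) e; rewrite !symM /=.
have := blocks false false.
rewrite /flip_block /swap_block /=.
by case: (a.2 (false, false)) => -[] [].
Qed.

Hypothesis hP : polytopal h.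
(** The parity of the number of factors hr1 has to be well defined on the
    dihedral subgroup; this is where finite odd types are excluded, and it
    makes that subgroup unchanged by doubling. *)
Variable chi : G -> bool.
Hypothesis chi1 : chi 1%g = false.
Hypothesis chi_r1 : forall x, dihedral h x -> chi (x * hr1 h)%g = ~~ chi x.
Hypothesis chi_r2 : forall x, dihedral h x -> chi (x * hr2 h)%g = chi x.

Lemma dihedral_doubled x : dihedral doubled x ->
  dihedral h x.1 /\ x.2 = (if chi x.1 then q1 else 1)%g.
Proof.
move=> Dx; split; first exact: gen_doubled_fst.
elim: Dx => [|y j Dy IH]; first by rewrite chi1.
have Dy1 := gen_doubled_fst Dy.
case: j => [|[|]] // _; rewrite /hgen /= IH; rewrite (chi_r1, chi_r2) //.
  by case: (chi y.1); rewrite ?mul1g//; apply: symP; case=> -[] [].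
by rewrite mulg1.
Qed.

Lemma doubled_polytopal : polytopal doubled.
Proof.
split.
- by move/(congr1 (@fst _ _)); apply: hr1_neq1.
- by move/(congr1 (@fst _ _)); apply: hr2_neq1.
- by move/(congr1 (@fst _ _)); apply: hr12_neq.
move=> x Dx Dx'; have [Dx1 x2] := dihedral_doubled Dx.
have [e|e] := dihedral_meet hP Dx1 (gen_doubled_fst Dx'); [left|right].
  by rewrite [x]surjective_pairing x2 e chi1.
rewrite [x]surjective_pairing x2 e.
by rewrite -[in chi _](mul1g (hr2 h)) chi_r2 ?chi1 //; apply: gen1.
Qed.

Lemma doubled_order p : group_order (hr1 h * hr2 h)%g p ->
  group_order (hr1 doubled * hr2 doubled)%g p.
Proof.
move=> op n; rewrite -(op n).
have fstX (x : G * sym V4) : (x ^+ n)%g.1 = (x.1 ^+ n)%g.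
  by elim: n => // n IH; rewrite !expgS /= IH.
set x := (_ * _)%g; split=> [e|e].
  by rewrite -(fstX x) e.
have Dx : dihedral doubled (x ^+ n)%g.
  elim: (n) => [|k IH]; first exact: gen1.
  by rewrite expgS; apply: dihedralM IH; apply: dihedralM; [apply: dihedral_hr1|apply: dihedral_hr2].
have [_ x2] := dihedral_doubled Dx.
by rewrite [LHS]surjective_pairing x2 fstX e chi1.
Qed.

Lemma doubled_finite : finite_set [set: G] -> finite_set [set: (G * sym V4)%type].
Proof.
move=> finG; rewrite -setXTT; apply: finite_setX => //; exact: finite_sym.
Qed.

Lemma doubled_many_faces (dP : polytopal doubled) m (x : nat -> G) :
  (forall j, j < m -> halved h (x j)) ->
  (forall j k, j < m -> k < m -> dihedral h ((x j)^-1 * x k)%g -> j = k) ->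
  `I_m #<= [set: halved_polyhedron dP].
Proof.
move=> Hx inj.
have /choice[y yE] : forall j, exists q, j < m -> halved doubled (x j, q).
  move=> j; have [jm|] := boolP (j < m); last by exists 1%g.
  by have [q] := gen_doubled_lift (Hx j jm); exists q.
apply: (@halved_many_faces _ _ dP m (fun j => (x j, y j))) => //.
by move=> j k jm km /gen_doubled_fst; apply: inj.
Qed.

End Doubling.

(** * Polyhedra of odd type *)

Section Wreath.

Local Open Scope ring_scope.

(** The elements hr1 and hr2 act on the index set I as reflections about 1/2
    and 0, and hr0 acts in each fibre over I by an involution. *)
Variables (I : comNzRingType) (Y : Type) (y0 : Y) (A : I -> Y -> Y).
Hypothesis AK : forall i, involutive (A i).
Hypothesis AN : forall i, A (- i) =1 A i.
Hypothesis AC : forall i y, A i (A (1 - i) y) = A (1 - i) (A i y).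
Hypothesis A_inj0 : forall i, A i =1 A 0 -> i = 0.
Hypothesis two_neq0 : 2 != 0 :> I.

Definition wreath0 (x : I * Y) : I * Y := (x.1, A x.1 x.2).
Definition wreath1 (x : I * Y) : I * Y := (1 - x.1, x.2).
Definition wreath2 (x : I * Y) : I * Y := (- x.1, x.2).

Lemma wreath0K : involutive wreath0.
Proof. by case=> i y; rewrite /wreath0 /= AK. Qed.
Lemma wreath1K : involutive wreath1.
Proof. by case=> i y; rewrite /wreath1 /= subKr. Qed.
Lemma wreath2K : involutive wreath2.
Proof. by case=> i y; rewrite /wreath2 /= opprK. Qed.

Lemma wreath02C : commute (sym_involution wreath0K) (sym_involution wreath2K).
Proof. by apply: symP => -[i y]; rewrite /= /wreath0 /wreath2 /= AN. Qed.

Lemma wreath101C : commute (sym_involution wreath1K)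
  (sym_involution wreath0K * sym_involution wreath1K * sym_involution wreath0K)%g.
Proof.
apply: symP => -[i y]; rewrite /= /wreath0 /wreath1 /= subKr.
by rewrite AC.
Qed.

Definition wreath : halving (sym (I * Y)) :=
  Halving (sym_involutionK wreath0K) (sym_involutionK wreath1K)
    (sym_involutionK wreath2K) wreath02C wreath101C.

Lemma wreath_dihedral x : dihedral wreath x ->
  exists (e : bool) n, forall i y, x (i, y) = ((-1) ^+ e * i + n, y).
Proof.
elim=> [|z j _ [e [n zE]]]; first by exists false, 0 => i y; rewrite mul1r addr0.
case: j => [|[|j]]// _; rewrite /hgen /=.
  exists (~~ e), ((-1) ^+ e + n) => i y; rewrite zE.
  by rewrite /= signrN; move: ((-1) ^+ e) => u; congr (_, _); ring.
exists (~~ e), n => i y; rewrite zE.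
by rewrite /= signrN; move: ((-1) ^+ e) => u; congr (_, _); ring.
Qed.

Lemma wreath_polytopal : polytopal wreath.
Proof.
have one0 : 1 <> 0 :> I by apply/eqP/oner_neq0.
have apply0 (f g : sym (I * Y)) i : f = g -> (f (i, y0)).1 = (g (i, y0)).1 by move->.
split.
- by move/(@apply0 _ _ 0); rewrite /= subr0.
- move/(@apply0 _ _ 1); rewrite /= => e; case/eqP: two_neq0.
  by rewrite -[2]/(1 + 1) -{1}e addNr.
- by move/(@apply0 _ _ 0); rewrite /= subr0 oppr0.
move=> x /wreath_dihedral[e [n xE]] /wreath_dihedral[e' [n' xE']].
have n0 : n = 0.
  apply: A_inj0 => y; have := xE' 0 (A 0 y).
  rewrite !symM /= /wreath0 /= AK xE mulr0 add0r /=.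
  by move=> [_ ->].
case: e xE => xE; [right|left]; apply: symP => -[i y];
  by rewrite xE n0 addr0 /= ?mulN1r ?mul1r.
Qed.

Lemma wreath_order p : (forall n, n%:R = 0 :> I <-> (odflt 0 p %| n)%N) ->
  group_order (hr1 wreath * hr2 wreath)%g p.
Proof.
move=> charI n; rewrite -charI.
have gX i y : ((hr1 wreath * hr2 wreath) ^+ n)%g (i, y) = (i + n%:R, y).
  rewrite symX; elim: n => [|n IH]; first by rewrite addr0.
  by rewrite iterS IH /= /wreath1 /wreath2 /= opprK -nat1r addrCA.
split=> [e|e].
  by have := gX 0 y0; rewrite e add0r => -[].
by apply: symP => -[i y]; rewrite gX e addr0.
Qed.

End Wreath.

Lemma Zp_nat_eq0 p n : (1 < p)%N -> (n%:R = 0 :> 'Z_p)%R <-> (p %| n)%N.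
Proof.
move=> p1; rewrite /dvdn; split=> [/(congr1 val)|/eqP e].
  by rewrite /= val_Zp_nat // => ->.
by apply: val_inj; rewrite /= val_Zp_nat // e.
Qed.

Section OddInternal.

Local Open Scope ring_scope.

Variable p : nat.
Hypotheses (p2 : (2 < p)%N) (p_odd : odd p).

Let p1 : (1 < p)%N := ltnW p2.

Definition flip_off0 (i : 'Z_p) (b : bool) := (i != 0) (+) b.

Lemma flip_off0K i : involutive (flip_off0 i).
Proof. by move=> b; rewrite /flip_off0 addbA addbb. Qed.
Lemma flip_off0N i : flip_off0 (- i) =1 flip_off0 i.
Proof. by move=> b; rewrite /flip_off0 oppr_eq0. Qed.
Lemma flip_off0C i y : flip_off0 i (flip_off0 (1 - i) y) = flip_off0 (1 - i) (flip_off0 i y).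
Proof. by rewrite /flip_off0 addbCA. Qed.
Lemma flip_off0_inj i : flip_off0 i =1 flip_off0 0 -> i = 0.
Proof. by move=> /(_ false); rewrite /flip_off0 eqxx; case: eqP. Qed.

Lemma Zp_small_neq0 n : (0 < n < p)%N -> n%:R != 0 :> 'Z_p.
Proof.
move=> /andP[n0 np]; apply/eqP => /(Zp_nat_eq0 _ p1)/(dvdn_leq n0).
by rewrite leqNgt np.
Qed.

Let W := wreath flip_off0K flip_off0N flip_off0C.

Lemma odd_wreath_polytopal : polytopal W.
Proof.
apply: (wreath_polytopal false) => //; first exact: flip_off0_inj.
exact: (@Zp_small_neq0 2).
Qed.

(** The product hr0 * hr1 * hr2 shifts the index by 1; in p steps it passes
    once over every index and so flips the bit p - 1 times, an even number. *)
Lemma odd_wreath_internal : halved W (hr0 W).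
Proof.
pose t := (hr0 W * (hr1 W * hr2 W))%g.
have tE i b : t (i, b) = (1 + i, flip_off0 (1 + i) b).
  by rewrite /t !symM /= /wreath0 /wreath1 /wreath2 /= opprK.
have tX n b : (n < p)%N -> iter n t (0, b) = (n%:R, odd n (+) b).
  elim: n => [|n IH] np //; rewrite iterS IH ?tE ?nat1r; last exact: ltnW.
  by rewrite /flip_off0 (@Zp_small_neq0 n.+1) //= addNb.
have tp : (t ^+ p = 1)%g.
  apply: symP => -[i b]; rewrite symX.
  have -> : (i, b) = iter i t (0, odd i (+) b).
    rewrite tX ?addbA ?addbb ?natr_Zp //.
    by case: i => i /= ; rewrite Zp_cast.
  rewrite -iterD addnC iterD; congr iter.
  have p0 := ltnW p1; have pp : p%:R = 0 :> 'Z_p by apply/Zp_nat_eq0.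
  have step q : q.+1 = p -> iter q.+1 t (0, odd i (+) b) = (0, odd i (+) b).
    move=> qp; rewrite iterS tX -?qp // tE nat1r qp pp /flip_off0 eqxx.
    by rewrite -[odd q]negbK -oddS qp p_odd.
  by have := step _ (prednK p0); rewrite prednK.
apply: odd_relation p_odd tp _.
rewrite /t mulgA hr0K mul1g; apply/dihedral_halved/dihedralM; [exact: dihedral_hr1|exact: dihedral_hr2].
Qed.

End OddInternal.

Lemma tperm_if (T : finType) (x y z : T) :
  tperm x y z = if z == x then y else if z == y then x else z.
Proof. by case: tpermP => [->|->|/eqP/negbTE-> /eqP/negbTE->] //; rewrite ?eqxx //; case: eqVneq. Qed.

Section OddExternal.

Local Open Scope ring_scope.

Variable p : nat.
Hypotheses (p4 : (4 < p)%N) (p_odd : odd p).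

Let p1 : (1 < p)%N := ltn_trans (isT : 1 < 4)%N p4.

Local Notation Y := 'I_4.
Let y0 : Y := @Ordinal 4 0 isT.
Let y1 : Y := @Ordinal 4 1 isT.
Let y2 : Y := @Ordinal 4 2 isT.
Let y3 : Y := @Ordinal 4 3 isT.

Let s01 : {perm Y} := tperm y0 y1.
Let t12 : {perm Y} := tperm y1 y2.

(** Three transpositions in the fibres over 0, 2 and -2, an odd permutation
    in total. The two transpositions generate a symmetric group of degree
    three with trivial centralizer; the fourth point is the only one fixed by
    both, from which the centralizer can be read off. *)
Definition three_swaps (i : 'Z_p) : {perm Y} :=
  if i == 0 then s01 else if (i == 2) || (i == -2) then t12 else 1%g.

Local Notation A := three_swaps.

Let nz n : (0 < n < 5)%N -> n%:R != 0 :> 'Z_p.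
Proof.
move=> /andP[n0 n5]; apply: (Zp_small_neq0 (ltn_trans (isT : 2 < 4)%N p4)).
by rewrite n0 (leq_trans n5 p4).
Qed.

Let eqN (i j : 'Z_p) n : (0 < n < 5)%N -> i - j = n%:R \/ j - i = n%:R -> (i == j) = false.
Proof.
move=> n5 [e|e]; apply/negbTE; [|rewrite eq_sym]; rewrite -subr_eq0 e; exact: nz.
Qed.

Lemma three_swaps0 : A 0 = s01. Proof. by rewrite /A eqxx. Qed.

Lemma three_swaps2 : A 2 = t12.
Proof. by rewrite /A eqxx (@eqN _ _ 2) //; left; ring. Qed.

Lemma three_swapsN2 : A (-2) = t12.
Proof. by rewrite /A eqxx orbT (@eqN _ _ 2) //; right; ring. Qed.

Lemma three_swaps1 : A 1 = 1%g.
Proof.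
rewrite /A (@eqN 1 0 1) ?(@eqN 1 2 1) ?(@eqN 1 (-2) 3) //; by [left; ring|right; ring].
Qed.

Lemma three_swapsN1 : A (-1) = 1%g.
Proof.
rewrite /A (@eqN (-1) 0 1) ?(@eqN (-1) 2 3) ?(@eqN (-1) (-2) 1) //; by [left; ring|right; ring].
Qed.

Lemma three_swaps3 : A 3 = 1%g \/ A 3 = t12.
Proof.
rewrite /A (@eqN 3 0 3) //; last by left; ring.
by case: ifP; [right|left].
Qed.

Lemma three_swapsK i : involutive (A i).
Proof.
by move=> y; rewrite /A; case: ifP => _; [|case: ifP => _]; rewrite ?perm1 // tpermK.
Qed.

Lemma three_swapsN i : A (- i) =1 A i.
Proof. by move=> y; rewrite /A oppr_eq0 eqr_opp orbC -eqr_oppLR. Qed.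

Lemma three_swapsC i y : A i (A (1 - i) y) = A (1 - i) (A i y).
Proof.
have [->|i0] := eqVneq i 0; first by rewrite subr0 three_swaps1 !perm1.
have [->|i2] := eqVneq i 2.
  by rewrite (_ : 1 - 2 = -1) ?three_swapsN1 ?perm1 //; ring.
have [->|iN2] := eqVneq i (-2).
  rewrite (_ : 1 - -2 = 3); last by ring.
  by rewrite three_swapsN2; case: three_swaps3 => ->; rewrite ?perm1.
by rewrite {1 4}/A (negbTE i0) (negbTE i2) (negbTE iN2) !perm1.
Qed.

Lemma s01_neq_t12 : s01 <> t12.
Proof. by move/permP/(_ y0); rewrite !tperm_if. Qed.

Lemma three_swaps_inj i : A i =1 A 0 -> i = 0.
Proof.
move=> /permP; rewrite three_swaps0 /A; case: eqP => // _.
case: ifP => _; first by move/esym/s01_neq_t12.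
by move/permP/(_ y0); rewrite perm1 tperm_if.
Qed.

Lemma three_swaps_odd : \big[addb/false]_i odd_perm (A i) = true.
Proof.
rewrite (bigD1 0) // (bigD1 2) /=; last by rewrite (@eqN 2 0 2)//; left; ring.
rewrite (bigD1 (-2)) /=; last first.
  rewrite (@eqN (-2) 0 2) ?(@eqN (-2) 2 4) //; by right; ring.
rewrite three_swaps0 three_swaps2 three_swapsN2 big1 ?odd_tperm //.
by move=> i /andP[/andP[/negbTE i0 /negbTE i2] /negbTE iN2]; rewrite /A i0 i2 iN2 odd_perm1.
Qed.

Lemma commute_s01_t12 (u : {perm Y}) :
  (forall y, u (s01 y) = s01 (u y)) -> (forall y, u (t12 y) = t12 (u y)) -> u = 1%g.
Proof.
move=> us ut.
have u3 : u y3 = y3.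
  have := us y3; have := ut y3; rewrite !tperm_if /=.
  by case: (u y3) => -[|[|[|[|]]]] // i4; move=> *; apply: val_inj.
have u2 : u y2 = y2.
  have := us y2; have /negP : u y2 != y3 by rewrite -u3 (inj_eq perm_inj).
  rewrite !tperm_if /=.
  by case: (u y2) => -[|[|[|[|]]]] // i4; move=> *; apply: val_inj.
have u0 : u y0 = y0.
  have := ut y0; have /negP : u y0 != y3 by rewrite -u3 (inj_eq perm_inj).
  rewrite !tperm_if /=.
  by case: (u y0) => -[|[|[|[|]]]] // i4; move=> *; apply: val_inj.
have u1 : u y1 = y1 by have := us y0; rewrite u0 !tperm_if.
apply/permP => y; rewrite perm1.
have [|] := boolP (y \in [:: y0; y1; y2; y3]).
  by rewrite !inE => /or4P[] /eqP ->.
by case: y => -[|[|[|[|]]]].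
Qed.

Let W := wreath three_swapsK three_swapsN three_swapsC.

Lemma three_swaps_polytopal : polytopal W.
Proof.
apply: (wreath_polytopal y0) => //; first exact: three_swaps_inj.
exact: (@nz 2).
Qed.

(** The sum of the signs of all fibre components is a character of the block-
    preserving permutations that is trivial on the three generators: hr1 and
    hr2 only permute the fibres, and the conjugate of hr1 contains the fibre
    components of hr0 twice. *)
Lemma three_swaps_halved x : halved W x -> exists (d : 'Z_p -> 'Z_p) (tau : 'Z_p -> {perm Y}),
  (forall i y, x (i, y) = (d i, tau i y)) /\ \big[addb/false]_i odd_perm (tau i) = false.
Proof.
elim=> [|z j _ [d [tau [zE odd_tau]]] _].
  exists id, (fun=> 1%g); split=> [i y|]; first by rewrite perm1.
  by rewrite big1 // => i _; rewrite odd_perm1.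
have sub1K : involutive (fun i : 'Z_p => 1 - i) by move=> i; rewrite subKr.
have oppK : involutive (fun i : 'Z_p => - i) by move=> i; rewrite opprK.
case: j => [|[|[|j]]].
- exists (fun i => d (1 - i)), (fun i => tau (1 - i)); split.
    by move=> i y; rewrite symM zE.
  by rewrite -[RHS]odd_tau [RHS](reindex_inj (inv_inj sub1K)).
- exists (fun i => d (- i)), (fun i => tau (- i)); split.
    by move=> i y; rewrite symM zE.
  by rewrite -[RHS]odd_tau [RHS](reindex_inj (inv_inj oppK)).
- exists (fun i => d (1 - i)), (fun i => A i * A (1 - i) * tau (1 - i))%g; split.
    by move=> i y; rewrite !permM symM; apply: zE.
  under eq_bigr do rewrite !odd_permM.
  have reindex1 (f : 'Z_p -> bool) : \big[addb/false]_i f (1 - i) = \big[addb/false]_i f i.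
    exact/esym/reindex_inj/inv_inj.
  have e1 : \big[addb/false]_i odd_perm (A (1 - i)) = \big[addb/false]_i odd_perm (A i).
    exact: (reindex1 (fun i => odd_perm (A i))).
  have e2 : \big[addb/false]_i odd_perm (tau (1 - i)) = \big[addb/false]_i odd_perm (tau i).
    exact: (reindex1 (fun i => odd_perm (tau i))).
  by rewrite 2!big_split /= e1 e2 odd_tau addbF addbb.
- by exists d, tau; rewrite (_ : hgen W j.+3 = 1%g) ?mulg1 // /hgen nth_default.
Qed.

(** If a has the effect of hr0 on the generators, then b = hr0 * a commutes
    with all of them. Commuting with hr1 and hr2 forces b to fix every index,
    as p is odd, and to act in all fibres in the same way; commuting with the
    third generator forces this action to centralize both transpositions. So
    a = hr0, whose total sign is odd. *)
Lemma three_swaps_external :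
  externally_self_dual (halved_polyhedron three_swaps_polytopal).
Proof.
apply: halved_external => a Ha aE.
have [d [tau [aP odd_tau]]] := three_swaps_halved Ha.
pose b := (hr0 W * a)%g.
have bC j : (j < 3)%N -> (b * hgen W j = hgen W j * b)%g.
  by move=> j3; rewrite -mulgA aE // -conj_hgen // /b !mulgA hr0K mul1g.
pose u i := (tau i * A (d i))%g.
have bE i y : b (i, y) = (d i, u i y) by rewrite /b /u permM symM aP.
have comm j i y : (j < 3)%N -> b (hgen W j (i, y)) = hgen W j (d i, u i y).
  by move=> j3; rewrite -bE -!symM bC.
have w0 i y : hgen W 0 (i, y) = (1 - i, y) by [].
have w1 i y : hgen W 1 (i, y) = (- i, y) by [].
have w2 i y : hgen W 2 (i, y) = (1 - i, A (1 - i) (A i y)) by [].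
have dN i : d (- i) = - d i by have := comm 1 i y0 isT; rewrite !w1 bE => -[].
have uN i : u (- i) = u i.
  by apply/permP => y; have := comm 1 i y isT; rewrite !w1 bE => -[].
have dV i : d (1 - i) = 1 - d i by have := comm 0 i y0 isT; rewrite !w0 bE => -[].
have uV i : u (1 - i) = u i.
  by apply/permP => y; have := comm 0 i y isT; rewrite !w0 bE => -[].
have d0 : d 0 = 0.
  have : (2 * d 0)%:R = 0 :> 'Z_p.
    by rewrite natrM natr_Zp mulr_natl mulr2n -{1}[0]oppr0 dN addNr.
  move/(Zp_nat_eq0 _ p1); rewrite Gauss_dvdr ?coprimen2 // => /(Zp_nat_eq0 _ p1).
  by rewrite natr_Zp.
have dS i : d (i + 1) = d i + 1.
  by rewrite -[in LHS](opprK i) (addrC _ 1) dV dN opprK addrC.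
have uS i : u (i + 1) = u i.
  by rewrite -[in LHS](opprK i) (addrC _ 1) uV uN.
have d_id i : d i = i.
  rewrite -(natr_Zp i); elim: (val i) => // n IH.
  by rewrite -natr1 dS IH.
have u_cst i : u i = u 0.
  by rewrite -(natr_Zp i); elim: (val i) => // n IH; rewrite -natr1 uS IH.
have u1 : u 0 = 1%g.
  have step i y : u 0 (A (1 - i) (A i y)) = A (1 - i) (A i (u 0 y)).
    by have := comm 2 i y isT; rewrite !w2 bE !d_id !(u_cst i) u_cst => -[].
  apply: commute_s01_t12 => y.
    by have := step 0 y; rewrite subr0 three_swaps0 three_swaps1 !perm1.
  have := step 2 y; rewrite three_swaps2 (_ : 1 - 2 = -1) ?three_swapsN1 ?perm1 //.
  by ring.
have tauE i : tau i = A i.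
  apply/permP => y; have : u i = 1%g by rewrite u_cst.
  rewrite /u d_id => /permP/(_ y); rewrite permM perm1 => e.
  by rewrite -[LHS](three_swapsK i) e.
by move: odd_tau; rewrite (eq_bigr (fun i => odd_perm (A i))) ?three_swaps_odd // => i _; rewrite tauE.
Qed.

End OddExternal.

(** * Polyhedra of type {4,4} *)

Section Torus.

Local Open Scope ring_scope.

(** The map {4,4} on the torus: hr1 and hr2 generate the symmetries of the
    square fixing the origin, and hr0 is the reflection in the line x = 1/2. *)
Variable m : nat.
Hypotheses (m2 : (2 < m)%N) (m_odd : odd m).

Let m1 : (1 < m)%N := ltnW m2.
Local Notation R := 'Z_m.

Definition torus0 (x : R * R) : R * R := (1 - x.1, x.2).
Definition torus1 (x : R * R) : R * R := (x.2, x.1).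
Definition torus2 (x : R * R) : R * R := (x.1, - x.2).

Lemma torus0K : involutive torus0. Proof. by case=> x y; rewrite /torus0 /= subKr. Qed.
Lemma torus1K : involutive torus1. Proof. by case. Qed.
Lemma torus2K : involutive torus2. Proof. by case=> x y; rewrite /torus2 /= opprK. Qed.

Lemma torus02C : commute (sym_involution torus0K) (sym_involution torus2K).
Proof. exact: symP. Qed.

Lemma torus101C : commute (sym_involution torus1K)
  (sym_involution torus0K * sym_involution torus1K * sym_involution torus0K)%g.
Proof. exact: symP. Qed.

Definition torus : halving (sym (R * R)) :=
  Halving (sym_involutionK torus0K) (sym_involutionK torus1K)
    (sym_involutionK torus2K) torus02C torus101C.

Lemma torus_dihedral x : dihedral torus x -> exists b e f : bool, forall u v,
  x (u, v) = if b then ((-1) ^+ e * v, (-1) ^+ f * u) else ((-1) ^+ e * u, (-1) ^+ f * v).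
Proof.
elim=> [|z j _ [b [e [f zE]]]].
  by exists false, false, false => u v; rewrite !mul1r.
case: j => [|[|j]]// _.
  by exists (~~ b), e, f => u v; rewrite symM zE /=; case: (b).
by case: b zE => zE; [exists true, (~~ e), f|exists false, e, (~~ f)] => u v;
  rewrite symM zE /= signrN mulrN mulNr.
Qed.

Let two_neq0 : 2 != 0 :> R. Proof. exact: (Zp_small_neq0 m2 (n := 2)). Qed.

Let N1_neq1 : - 1 <> 1 :> R.
Proof. by move/eqP; rewrite eq_sym -subr_eq0 opprK; exact/negP. Qed.

Let signr_eq1 (e : bool) : (-1) ^+ e = 1 :> R -> e = false.
Proof.
by case: e => //; rewrite expr1 => /N1_neq1.
Qed.

Lemma torus_polytopal : polytopal torus.
Proof.
have apply_at (f g : sym (R * R)) i : f = g -> f i = g i by move->.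
have one0 : 1 <> 0 :> R by apply/eqP/oner_neq0.
split.
- by move/(@apply_at _ _ (1, 0))/(congr1 snd).
- by move/(@apply_at _ _ (0, 1))/(congr1 snd)/N1_neq1.
- by move/(@apply_at _ _ (1, 0))/(congr1 fst)/esym.
move=> x /torus_dihedral[b [e [f xE]]] /torus_dihedral[b' [e' [f' xE']]].
have : x (1, 0) = (1, 0).
  have := congr1 torus0 (xE' 0 0); rewrite !mulr0 if_same !symM /= torus0K.
  by rewrite /torus0 /= subr0.
rewrite xE; case: b xE => xE; rewrite !mulr0 mulr1 => /(congr1 fst) /=.
  by move/esym/one0.
move/signr_eq1 => e0.
case: f xE => xE; [right|left]; apply: symP => -[u v]; rewrite xE e0 mul1r //=.
  by rewrite mulN1r.
by rewrite mul1r.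
Qed.

Lemma torus_order : group_order (hr1 torus * hr2 torus)%g (Some 4).
Proof.
have : forall x y, (hr1 torus * hr2 torus)%g (x, y) = (- y, x) by [].
move: (hr1 torus * hr2 torus)%g => g gE.
have g4 : (g ^+ 4 = 1)%g by apply: symP => -[x y]; rewrite symX /= !gE !opprK.
move=> n; rewrite /= /dvdn {1}(divn_eq n 4) mulnC expgnDr expgnA g4 expg1n mul1g.
split=> [|/eqP -> //]; have := ltn_pmod n (isT : (0 < 4)%N).
have apply_at (f h : sym (R * R)) i : f = h -> f i = h i by move->.
have one0 : 1 <> 0 :> R by apply/eqP/oner_neq0.
case: (n %% 4)%N => [|[|[|[|]]]] // _ /(@apply_at _ _ (1, 0)); rewrite symX /= !gE => /(congr1 fst) /=.
- by rewrite !oppr0 => /esym/one0.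
- by move/N1_neq1.
- by rewrite !oppr0 => /esym/one0.
Qed.

Let t : sym (R * R) := (hr0 torus * (hr1 torus * hr2 torus * hr1 torus))%g.

Let tE n x y : (t ^+ n)%g (x, y) = (x + n%:R, y).
Proof.
rewrite symX; elim: n => [|n IH]; first by rewrite addr0.
by rewrite iterS IH /t !symM /= /torus0 /torus1 /torus2 /= opprK -nat1r addrCA.
Qed.

Lemma torus_internal : halved torus (hr0 torus).
Proof.
apply: (@odd_relation _ _ t m) => //.
  apply: symP => -[x y]; rewrite tE.
  by rewrite (_ : m%:R = 0) ?addr0 //; apply/Zp_nat_eq0.
rewrite /t mulgA hr0K mul1g; apply/dihedral_halved.
by do !apply: dihedralM; do ?[exact: dihedral_hr1|exact: dihedral_hr2].
Qed.

Lemma torus_translations_halved j : halved torus (t ^+ j)%g.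
Proof.
apply: halvedX; rewrite /t; apply: halvedM; first exact: torus_internal.
apply/dihedral_halved.
by do !apply: dihedralM; do ?[exact: dihedral_hr1|exact: dihedral_hr2].
Qed.

Lemma Zp_natr_inj p j k : (1 < p)%N -> (j < p)%N -> (k < p)%N -> j%:R = k%:R :> 'Z_p -> j = k.
Proof. by move=> p1 jp kp /(congr1 val); rewrite /= !val_Zp_nat // !modn_small. Qed.

Lemma torus_translations_dihedral j k : (j < m)%N -> (k < m)%N ->
  dihedral torus ((t ^+ j)^-1 * t ^+ k)%g -> j = k.
Proof.
move=> jm km /torus_dihedral[b [e [f E]]].
have := E 0 0; rewrite !mulr0 if_same symM => /(congr1 (t ^+ j)%g).
rewrite -symM mulgV; rewrite !tE !add0r => /(congr1 fst) /= jk.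
by apply/esym/(Zp_natr_inj m1).
Qed.

(** The parity of hr1 tells whether the coordinate axes are exchanged. *)
Definition torus_swaps (x : sym (R * R)) : bool := (x (1, 0)).1 == 0.

Lemma torus_swaps_r1 x : dihedral torus x ->
  torus_swaps (x * hr1 torus)%g = ~~ torus_swaps x.
Proof.
move=> /torus_dihedral[b [e [f E]]]; rewrite /torus_swaps symM /= /torus1 /= !E.
by case: b {E}; rewrite /= mulr0 mulr1 ?eqxx signr_eq0.
Qed.

Lemma torus_swaps_r2 x : dihedral torus x ->
  torus_swaps (x * hr2 torus)%g = torus_swaps x.
Proof. by rewrite /torus_swaps symM /= /torus2 /= oppr0. Qed.

Lemma torus_swaps_1 : torus_swaps 1%g = false.
Proof. by rewrite /torus_swaps /= oner_eq0. Qed.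

End Torus.

(** * Polyhedra of even type at least six and of infinite type *)

Section Spider.

Local Open Scope ring_scope.

(** The points are the indices in I, which will be Z_p or the integers, and
    two hubs, one for each parity of indices; every point is replaced by a
    fibre Z_m. *)
Variables (I : comNzRingType) (par : I -> bool) (m : nat).
Hypothesis parD : forall i j, par (i + j) = par i (+) par j.
Hypothesis par1 : par 1 = true.
Hypothesis four_neq0 : 4 != 0 :> I.
Hypotheses (m1 : (1 < m)%N) (m_odd : odd m).

Local Notation K := 'Z_m.
Local Notation S := ((I + bool) * K)%type.

Let par0 : par 0 = false. Proof. by have := parD 0 0; rewrite addr0; case: par. Qed.
Let parN i : par (- i) = par i.
Proof. by have := parD i (- i); rewrite subrr par0; case: par; case: par. Qed.
Let par2 : par 2 = false. Proof. by rewrite -[2]/(1 + 1) parD addbb. Qed.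

(** On points, this is the product of the transpositions of k with the even
    hub and of u with l. The fibre coordinate is shifted along the second
    one, which makes the order of the element t below a multiple of m. *)
Definition spider_swap (k u l : I) (x : S) : S :=
  match x.1 with
  | inl i => if i == k then (inr false, x.2) else
             if i == u then (inl l, x.2 - 1) else
             if i == l then (inl u, x.2 + 1) else x
  | inr false => (inl k, x.2)
  | inr true => x
  end.

Definition spider0 : S -> S := spider_swap 0 2 (-2).
Definition spider1 (x : S) : S :=
  (match x.1 with inl i => inl (1 - i) | inr b => inr (~~ b) end, - x.2).
Definition spider2 (x : S) : S :=
  (match x.1 with inl i => inl (- i) | inr b => inr b end, - x.2).

Let two_neq0 : 2 != 0 :> I.
Proof. by apply: contra four_neq0 => /eqP e; rewrite (natrM _ 2 2) e mul0r. Qed.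

Let N2_neq2 : (-2 == 2 :> I) = false.
Proof. by apply/negbTE; rewrite eq_sym -subr_eq0 opprK -(natrD _ 2 2). Qed.

Let two_eq0 : (2 == 0 :> I) = false. Proof. exact: negbTE. Qed.
Let N2_eq0 : (-2 == 0 :> I) = false. Proof. by rewrite oppr_eq0 two_eq0. Qed.

Lemma spider0K : involutive spider0.
Proof.
rewrite /spider0 /spider_swap => -[[i|[]] s] //=; last by rewrite eqxx.
have [->|i0] := eqVneq i 0; first by [].
have [->|i2] := eqVneq i 2; first by rewrite /= N2_eq0 N2_neq2 eqxx subrK.
have [->|iN2] := eqVneq i (-2); first by rewrite /= two_eq0 eqxx addrK.
by rewrite /= (negbTE i0) (negbTE i2) (negbTE iN2).
Qed.

Lemma spider1K : involutive spider1.
Proof. by case=> -[i|b] s; rewrite /spider1 /= opprK ?subKr ?negbK. Qed.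
Lemma spider2K : involutive spider2.
Proof. by case=> -[i|b] s; rewrite /spider2 /= !opprK. Qed.

Let r0 := sym_involution spider0K.
Let r1 := sym_involution spider1K.
Let r2 := sym_involution spider2K.

Lemma spider02C : commute r0 r2.
Proof.
apply: symP => -[[i|[]] s] //=; rewrite /spider0 /spider2 /spider_swap /= ?oppr0 //.
rewrite oppr_eq0; have [//|i0] := eqVneq i 0.
rewrite eqr_oppLR; have [->|i2] := eqVneq i (-2).
  by rewrite N2_neq2 /=; congr (_, _); rewrite opprD.
rewrite eqr_opp; have [_|//] := eqVneq i 2.
by rewrite /= opprK opprB addrC.
Qed.

Definition spider_color (x : S) : bool := match x.1 with inl i => par i | inr b => b end.

Lemma spider0_color x : spider_color (spider0 x) = spider_color x.
Proof.
case: x => -[i|[]] s //=; rewrite /spider_color /spider0 /spider_swap /=.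
case: eqP => [->|_] //=; case: eqP => [->|_] /=; first by rewrite parN.
by case: eqP => [->|_]; rewrite /= ?parN.
Qed.

Lemma spider1_color x : spider_color (spider1 x) = ~~ spider_color x.
Proof. by case: x => -[i|b] s //=; rewrite /spider_color /= parD par1 parN. Qed.

(** The element hr0 only moves even points and its conjugate by hr1 only odd
    ones; hence they commute. *)
Lemma spider0_odd x : spider_color x -> spider0 x = x.
Proof.
case: x => -[i|[]] s //=; rewrite /spider_color /spider0 /spider_swap /=.
case: eqP => [->|_]; first by rewrite par0.
case: eqP => [->|_]; first by rewrite par2.
by case: eqP => [->|//]; rewrite parN par2.
Qed.

Lemma spider101C : commute r1 (r0 * r1 * r0)%g.
Proof.
apply: symP => x; rewrite !symM /=.
have [odd_x|even_x] := boolP (spider_color x).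
  rewrite (spider0_odd odd_x) [in RHS]spider0_odd ?spider1K //.
  by rewrite spider1_color spider0_color spider1_color negbK.
rewrite (@spider0_odd (spider1 (spider0 x))); last by rewrite spider1_color spider0_color.
by rewrite (@spider0_odd (spider1 x)) ?spider1_color // !spider1K.
Qed.

Definition spider : halving (sym S) :=
  Halving (sym_involutionK spider0K) (sym_involutionK spider1K)
    (sym_involutionK spider2K) spider02C spider101C.

Lemma spider_dihedral x : dihedral spider x -> exists (e : bool) n,
  (forall i s, x (inl i, s) = (inl ((-1) ^+ e * i + n), (-1) ^+ e * s)) /\
  (forall b s, x (inr b, s) = (inr (b (+) par n), (-1) ^+ e * s)).
Proof.
elim=> [|z j _ [e [n [zl zr]]]].
  by exists false, 0; split=> [i|b] s; rewrite ?par0 ?addbF ?mul1r ?addr0.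
case: j => [|[|j]]// _.
  exists (~~ e), ((-1) ^+ e + n); split=> [i|b] s; rewrite symM /= /spider1 /=.
    rewrite zl signrN; congr (inl _, _); last by rewrite ?signrN mulrN mulNr.
    by move: ((-1) ^+ e) => u; ring.
  rewrite zr signrN; congr (inr _, _); last by rewrite ?signrN mulrN mulNr.
  rewrite parD (_ : par ((-1) ^+ e) = true) ?addTb ?addbN ?addNb //.
  by case: (e); rewrite ?parN.
exists (~~ e), n; split=> [i|b] s; rewrite symM /= /spider2 /=.
  by rewrite zl !signrN !mulrN !mulNr.
by rewrite zr signrN mulrN mulNr.
Qed.

Lemma spider_polytopal : polytopal spider.
Proof.
have apply_at (f g : sym S) i : f = g -> (f i).1 = (g i).1 by move->.
split.
- by move/(@apply_at _ _ (inr false, 0)).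
- by move/(@apply_at _ _ (inl 2, 0)) => -[/eqP]; rewrite N2_neq2.
- by move/(@apply_at _ _ (inr false, 0)).
move=> x /spider_dihedral[e [n [xl xr]]] /spider_dihedral[e' [n' [_ xr']]].
have n0 : n = 0.
  have := xr' false 0; rewrite !symM /= /spider0 [spider_swap _ _ _ (inr _, _)]/=.
  rewrite xl mulr0 add0r /spider_swap /=.
  by case: eqP => // _; case: ifP => // _; case: ifP.
case: e xl xr => xl xr; [right|left]; apply: symP => -[[i|b] s];
  by rewrite ?xl ?xr n0 ?addr0 ?par0 ?addbF /= ?mulN1r ?mul1r.
Qed.

Lemma spider_rotationX n x : ((r1 * r2) ^+ n)%g x =
  (match x.1 with inl i => inl (i + n%:R) | inr b => inr (b (+) odd n) end, x.2).
Proof.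
case: x => z s; rewrite symX; elim: n => [|n IH].
  by case: z => [i|b] /=; rewrite ?addr0 ?addbF.
rewrite iterS IH /=; case: z {IH} => [i|b]; rewrite /spider1 /spider2 /= !opprK.
  by rewrite -nat1r addrCA.
by rewrite addbN.
Qed.

Lemma spider_order p : (forall n, n%:R = 0 :> I <-> (odflt 0 p %| n)%N) ->
  group_order (hr1 spider * hr2 spider)%g p.
Proof.
move=> charI n; rewrite -charI; split=> [e|e].
  have := spider_rotationX n (inl 0, 0); rewrite [(_ ^+ n)%g]e /= add0r.
  by move/(congr1 fst) => -[].
have par_n k : par k%:R = odd k by elim: k => [|k IH]; rewrite ?par0 // -natr1 parD IH par1 addbT.
apply: symP => -[[i|b] s]; rewrite spider_rotationX /= ?e ?addr0 //.
by rewrite -par_n e par0 addbF.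
Qed.

(** t is the product of the conjugates of hr0 by the powers 0, 2 and 4 of the
    rotation. On points it is a 5-cycle in general, and is a 3-cycle or
    trivial when 8 = 0 or 6 = 0, respectively. *)
Let g : sym S := (r1 * r2)%g.
Let t : sym S := (r0 * ((g ^+ 2) * r0 * (g ^+ 2)^-1 * ((g ^+ 4) * r0 * (g ^+ 4)^-1)))%g.

Definition spider_walk (x : S) : S :=
  spider0 (spider_swap 2 4 0 (spider_swap 4 6 2 x)).

Lemma spider_conj k x : ~~ odd k ->
  ((g ^+ k) * r0 * (g ^+ k)^-1)%g x = spider_swap k%:R (2 + k%:R) (-2 + k%:R) x.
Proof.
move=> k_even; have gV y : ((g ^+ k)^-1)%g y =
    (match y.1 with inl i => inl (i - k%:R) | inr b => inr b end, y.2).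
  apply: (@sym_inj _ (g ^+ k)%g); rewrite -symM mulgV spider_rotationX.
  by case: y => -[i|b] s /=; rewrite ?subrK // (negbTE k_even) addbF.
rewrite !symM gV /= /spider0; case: x => -[i|[]] s; rewrite /spider_swap /=.
- rewrite subr_eq add0r; case: eqP => _; first by rewrite spider_rotationX /= (negbTE k_even).
  rewrite subr_eq; case: eqP => _; first by rewrite spider_rotationX.
  rewrite subr_eq; case: eqP => _; first by rewrite spider_rotationX.
  by rewrite spider_rotationX /= subrK.
- by rewrite spider_rotationX /= (negbTE k_even).
- by rewrite spider_rotationX /= add0r.
Qed.

Lemma spider_walkE x : t x = spider_walk x.
Proof.
rewrite /t symM (symM (g ^+ 2 * r0 * _)%g) !spider_conj // addNr -!natrD.
by rewrite (_ : -2 + 4 = 2) // (natrD _ 2 2) addKr.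
Qed.

(** The shift v along the fibre is left unspecified: only the cycle lengths
    on points matter for the order to be odd. *)
Definition walks n (z z' : I + bool) :=
  exists v, forall s, iter n spider_walk (z, s) = (z', s + v).

Lemma walks_trans n n' z z' z'' : walks n z z' -> walks n' z' z'' -> walks (n' + n) z z''.
Proof.
by move=> [v zv] [v' zv']; exists (v + v') => s; rewrite iterD zv zv' addrA.
Qed.

Lemma walks_mul k n z : walks n z z -> walks (k * n) z z.
Proof.
move=> zn; elim: k => [|k IH]; first by exists 0 => s; rewrite addr0.
by rewrite mulSn; apply: walks_trans IH zn.
Qed.

Lemma walks1 z z' v : (forall s, spider_walk (z, s) = (z', s + v)) -> walks 1 z z'.
Proof. by exists v. Qed.

Let neq2 (i j : I) k : k != 0 -> i - j = k -> ((i == j) = false) * ((j == i) = false).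
Proof. by move=> k0 e; split; apply/negbTE; [|rewrite eq_sym]; rewrite -subr_eq0 e. Qed.

Let n02 : ((2 == 0 :> I) = false) * ((0 == 2 :> I) = false).
Proof. by apply: (neq2 two_neq0); ring. Qed.
Let n24 : ((4 == 2 :> I) = false) * ((2 == 4 :> I) = false).
Proof. by apply: (neq2 two_neq0); ring. Qed.
Let n46 : ((6 == 4 :> I) = false) * ((4 == 6 :> I) = false).
Proof. by apply: (neq2 two_neq0); ring. Qed.
Let n04 : ((4 == 0 :> I) = false) * ((0 == 4 :> I) = false).
Proof. by apply: (neq2 four_neq0); ring. Qed.
Let n26 : ((6 == 2 :> I) = false) * ((2 == 6 :> I) = false).
Proof. by apply: (neq2 four_neq0); ring. Qed.
Let nN2 : ((2 == -2 :> I) = false) * ((-2 == 2 :> I) = false).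
Proof. by apply: (neq2 four_neq0); ring. Qed.
Let nN0 : ((0 == -2 :> I) = false) * ((-2 == 0 :> I) = false).
Proof. by apply: (neq2 two_neq0); ring. Qed.

Let near := (n02, n24, n46, n04, n26, nN2, nN0, eqxx).

Let walk_hub : walks 1 (inr false) (inr false).
Proof.
apply: (@walks1 _ _ (-1)) => s; rewrite /spider_walk /spider0 /spider_swap /=.
by rewrite !near /= !near.
Qed.

Let walk_off i : i != 0 -> i != 2 -> i != 4 -> i != 6 -> i != -2 -> walks 1 (inl i) (inl i).
Proof.
move=> /negbTE i0 /negbTE i2 /negbTE i4 /negbTE i6 /negbTE iN2.
apply: (@walks1 _ _ 0) => s; rewrite /spider_walk /spider0 /spider_swap /= addr0.
by rewrite i4 i6 i2 /= i2 i4 i0 /= i0 i2 iN2.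
Qed.

Lemma spider_walk15 z : walks 15 z z.
Proof.
case: z => [i|[]]; last 2 first.
- by apply: (@walks_mul 15 1); apply: (@walks1 _ _ 0) => s; rewrite addr0.
- exact: (walks_mul 15 walk_hub).
have [e6|n6] := eqVneq (6 : I) 0.
  have eN : -2 = 4 :> I by rewrite -[LHS]addr0 -e6; ring.
  have [i0|i0] := eqVneq i 0.
    apply: (@walks_mul 15 1); rewrite i0; apply: (@walks1 _ _ (-1)) => s.
    rewrite /spider_walk /spider0 /spider_swap eN e6 /=.
    by do 4!rewrite ?near /=; rewrite ?addrA.
  have [i2|i2] := eqVneq i 2.
    apply: (@walks_mul 15 1); rewrite i2; apply: (@walks1 _ _ (1 + 1 + 1)) => s.
    rewrite /spider_walk /spider0 /spider_swap eN e6 /=.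
    by do 4!rewrite ?near /=; rewrite ?addrA.
  have [i4|i4] := eqVneq i 4.
    apply: (@walks_mul 15 1); rewrite i4; apply: (@walks1 _ _ (- 1)) => s.
    rewrite /spider_walk /spider0 /spider_swap eN e6 /=.
    by do 4!rewrite ?near /=; rewrite ?addrA.
  by apply: (@walks_mul 15 1); apply: walk_off; rewrite ?e6 ?eN.
have n06 : ((6 == 0 :> I) = false) * ((0 == 6 :> I) = false).
  by apply: (neq2 n6); rewrite subr0.
have [e8|n8] := eqVneq (8 : I) 0.
  have eN : -2 = 6 :> I by rewrite -[LHS]addr0 -e8; ring.
  have w60 : walks 1 (inl 6) (inl 0).
    apply: (@walks1 _ _ (-1)) => s.
    rewrite /spider_walk /spider0 /spider_swap eN /=.
    by do 4!rewrite ?near ?n06 /=; rewrite ?addrA.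
  have w04 : walks 1 (inl 0) (inl 4).
    apply: (@walks1 _ _ 1) => s.
    rewrite /spider_walk /spider0 /spider_swap eN /=.
    by do 4!rewrite ?near ?n06 /=; rewrite ?addrA.
  have w46 : walks 1 (inl 4) (inl 6).
    apply: (@walks1 _ _ (-1)) => s.
    rewrite /spider_walk /spider0 /spider_swap eN /=.
    by do 4!rewrite ?near ?n06 /=; rewrite ?addrA.
  have w22 : walks 1 (inl 2) (inl 2).
    apply: (@walks1 _ _ (1 + 1)) => s.
    rewrite /spider_walk /spider0 /spider_swap eN /=.
    by do 4!rewrite ?near ?n06 /=; rewrite ?addrA.
  have [->|i6] := eqVneq i 6; first exact: (walks_mul 5 (walks_trans w60 (walks_trans w04 w46))).
  have [->|i0] := eqVneq i 0; first exact: (walks_mul 5 (walks_trans w04 (walks_trans w46 w60))).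
  have [->|i4] := eqVneq i 4; first exact: (walks_mul 5 (walks_trans w46 (walks_trans w60 w04))).
  have [->|i2] := eqVneq i 2; first exact: (walks_mul 15 w22).
  by apply: (@walks_mul 15 1); apply: walk_off; rewrite ?eN.
have n62 : ((6 == -2 :> I) = false) * ((-2 == 6 :> I) = false).
  by apply: (neq2 n8); ring.
have n42 : ((4 == -2 :> I) = false) * ((-2 == 4 :> I) = false).
  by apply: (neq2 n6); ring.
have w22 : walks 1 (inl (-2)) (inl 2).
  apply: (@walks1 _ _ 1) => s; rewrite /spider_walk /spider0 /spider_swap /=.
  by do 4!rewrite ?near ?n06 ?n62 ?n42 /=; rewrite ?addrA.
have w26 : walks 1 (inl 2) (inl 6).
  apply: (@walks1 _ _ 1) => s; rewrite /spider_walk /spider0 /spider_swap /=.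
  by do 4!rewrite ?near ?n06 ?n62 ?n42 /=; rewrite ?addrA.
have w60 : walks 1 (inl 6) (inl 0).
  apply: (@walks1 _ _ (-1)) => s; rewrite /spider_walk /spider0 /spider_swap /=.
  by do 4!rewrite ?near ?n06 ?n62 ?n42 /=; rewrite ?addrA.
have w04 : walks 1 (inl 0) (inl 4).
  apply: (@walks1 _ _ 1) => s; rewrite /spider_walk /spider0 /spider_swap /=.
  by do 4!rewrite ?near ?n06 ?n62 ?n42 /=; rewrite ?addrA.
have w42 : walks 1 (inl 4) (inl (-2)).
  apply: (@walks1 _ _ (-1)) => s; rewrite /spider_walk /spider0 /spider_swap /=.
  by do 4!rewrite ?near ?n06 ?n62 ?n42 /=; rewrite ?addrA.
have cyc a b c d e : walks 1 a b -> walks 1 b c -> walks 1 c d -> walks 1 d e ->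
    walks 1 e a -> walks 15 a a.
  move=> ab bc cd de ea; apply: (walks_mul 3 (n := 5)).
  exact: walks_trans ab (walks_trans bc (walks_trans cd (walks_trans de ea))).
have [->|i6] := eqVneq i 6; first exact: cyc w60 w04 w42 w22 w26.
have [->|i0] := eqVneq i 0; first exact: cyc w04 w42 w22 w26 w60.
have [->|i4] := eqVneq i 4; first exact: cyc w42 w22 w26 w60 w04.
have [->|i2] := eqVneq i 2; first exact: cyc w26 w60 w04 w42 w22.
have [->|iN2] := eqVneq i (-2); first exact: cyc w22 w26 w60 w04 w42.
by apply: (@walks_mul 15 1); apply: walk_off.
Qed.

Let walk_power : (t ^+ (15 * m) = 1)%g.
Proof.
apply: symP => -[z s]; rewrite symX (eq_iter spider_walkE) mulnC.
have [v zv] := spider_walk15 z.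
have walk_n n : iter (n * 15) spider_walk (z, s) = (z, s + v *+ n).
  elim: n => [|n IH]; first by rewrite addr0.
  by rewrite mulSn iterD IH zv -addrA mulrSr.
rewrite walk_n -mulr_natr (_ : m%:R = 0) ?mulr0 ?addr0 //.
exact/Zp_nat_eq0.
Qed.

Let rot_halved k : halved spider (g ^+ k)%g.
Proof.
apply/halvedX/dihedral_halved/dihedralM; [exact: dihedral_hr1|exact: dihedral_hr2].
Qed.

Let walk_coset : halved spider (r0 * t)%g.
Proof.
rewrite /t mulgA (hr0K spider) mul1g.
have -> : (g ^+ 2 * r0 * (g ^+ 2)^-1 * (g ^+ 4 * r0 * (g ^+ 4)^-1) =
   g ^+ 2 * (r0 * g ^+ 2 * r0) * (g ^+ 4)^-1)%g.
  rewrite (expgnDr g 2 2); move: (g ^+ 2)%g => a.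
  by rewrite !mulgA mulgVK.
apply: halvedM; last exact/halvedV/rot_halved.
by apply: halvedM; [|apply: halvedJ]; apply: rot_halved.
Qed.

Lemma spider_internal : halved spider r0.
Proof. by apply: (odd_relation _ walk_power walk_coset); rewrite oddM. Qed.

Lemma spider_walks_halved j : halved spider (t ^+ j)%g.
Proof.
apply: halvedX; rewrite -[t]mul1g -(hr0K spider) -mulgA.
by apply: halvedM walk_coset; apply: spider_internal.
Qed.

(** The powers of t move the even hub along its fibre, while the dihedral
    subgroup preserves the zero section. *)
Lemma spider_walks_dihedral j k : (j < m)%N -> (k < m)%N ->
  dihedral spider ((t ^+ j)^-1 * t ^+ k)%g -> j = k.
Proof.
move=> jm km /spider_dihedral[e [n [_ xr]]].
have hubX l : (t ^+ l)%g (inr false, 0) = (inr false, - l%:R).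
  rewrite symX (eq_iter spider_walkE); elim: l => [|l IH]; first by rewrite oppr0.
  rewrite iterS IH /spider_walk /spider0 /spider_swap /= !near /= !near.
  by rewrite -natr1 opprD.
have fixX l s : (t ^+ l)%g (inr true, s) = (inr true, s).
  by rewrite symX (eq_iter spider_walkE); elim: l => // l IH; rewrite iterS IH.
have := xr false 0; rewrite mulr0 symM => /(congr1 (t ^+ j)%g).
rewrite -symM mulgV sym1 hubX; case: (_ (+) _); first by rewrite fixX.
rewrite hubX => /(congr1 snd) /= /oppr_inj.
by move/(Zp_natr_inj m1 km jm).
Qed.

(** The parity of hr1 tells whether the hubs are exchanged. *)
Definition spider_swaps (x : sym S) : bool := (x (inr false, 0)).1 == inr true.

Lemma spider_swaps_1 : spider_swaps 1%g = false. Proof. by []. Qed.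

Lemma spider_swaps_r1 x : dihedral spider x ->
  spider_swaps (x * hr1 spider)%g = ~~ spider_swaps x.
Proof.
move=> /spider_dihedral[e [n [_ xr]]]; rewrite /spider_swaps symM /= /spider1 /=.
by rewrite !xr; case: (par n).
Qed.

Lemma spider_swaps_r2 x : dihedral spider x ->
  spider_swaps (x * hr2 spider)%g = spider_swaps x.
Proof. by rewrite /spider_swaps symM /= /spider2 /= oppr0. Qed.

End Spider.

(** * Infinite families *)

Lemma isomorphic_card (P Q : polytope 3) : isomorphic P Q -> [set: P] #= [set: Q].
Proof.
case=> f [[g fK gK] _]; rewrite card_eq_sym.
have -> : [set: Q] = f @` [set: P].
  by apply/seteqP; split=> // y _; exists (g y).
by apply: inj_card_eq => x y _ _; apply: can_inj fK _ _.
Qed.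

(** Each polyhedron is chosen with more faces than the previous one; being
    finite, they are then told apart by their numbers of faces. *)
Lemma infinitely_many_unbounded (A : polytope 3 -> Prop) :
  (forall N, exists P, [/\ A P, finite_set [set: P] & `I_N #<= [set: P]]) ->
  infinitely_many_polyhedra A.
Proof.
move=> unb; have /choice[F FP] : forall N, exists Pc : polytope 3 * nat,
    [/\ A Pc.1, [set: Pc.1] #= `I_Pc.2 & N <= Pc.2].
  move=> N; have [P [AP /finite_setP[c cP] NP]] := unb N; exists (P, c); split=> //.
  by rewrite -card_le_II -(card_le_eqr cP).
pose n := fix n k := if k is k'.+1 then (F (n k')).2.+1 else 0.
exists (fun k => (F (n k)).1); split=> [k|]; first by case: (FP (n k)).
have lt_c j k : j < k -> (F (n j)).2 < (F (n k)).2.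
  elim: k => // k IH; rewrite ltnS leq_eqVlt => jk.
  have [_ _ l] := FP (n k.+1); apply: leq_trans l.
  by case/predU1P: jk => [->|/IH/ltnW //].
have not_iso j k : j < k -> [set: (F (n j)).1] #= [set: (F (n k)).1] -> False.
  move=> /lt_c jk; have [[_ cj _] [_ ck _]] := (FP (n j), FP (n k)).
  rewrite (card_eql cj) (card_eqr ck) => /card_eq_II e.
  by rewrite e ltnn in jk.
move=> j k /eqP; rewrite neq_ltn => /orP[jk|kj] /isomorphic_card; first exact: not_iso.
by rewrite card_eq_sym; apply: not_iso.
Qed.

Definition r1_parity (G : groupType) (h : halving G) (chi : G -> bool) :=
  [/\ chi 1%g = false,
      forall x, dihedral h x -> chi (x * hr1 h)%g = ~~ chi x &
      forall x, dihedral h x -> chi (x * hr2 h)%g = chi x].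

Section EvenType.

Variables (p N : nat).
Hypotheses (p4 : 3 < p) (p_even : ~~ odd p).

Lemma even_halving : exists (G : groupType) (h : halving G),
  [/\ polytopal h, group_order (hr1 h * hr2 h)%g (Some p) & halved h (hr0 h)] /\
  [/\ exists chi, r1_parity h chi, finite_set [set: G] &
      exists x : nat -> G, (forall j, halved h (x j)) /\
        (forall j k, j < N -> k < N -> dihedral h ((x j)^-1 * x k)%g -> j = k)].
Proof.
(* Any odd m with m >= 3 and m >= N will do. *)
pose m := N.*2.+3; have m_odd : odd m by rewrite /= odd_double.
have m2 : 2 < m by [].
have Nm j : j < N -> j < m by rewrite /m -addnn; lia.
have [->|p5] := eqVneq p 4.
  exists (sym ('Z_m * 'Z_m)), (torus m); split.
    split; [exact: torus_polytopal|exact: torus_order|exact: torus_internal].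
  split; last 1 first.
  - eexists; split=> [j|j k jN kN]; first exact: torus_translations_halved.
    by apply: torus_translations_dihedral => //; apply: Nm.
  - exists (@torus_swaps m); split; [exact: torus_swaps_1|exact: torus_swaps_r1|exact: torus_swaps_r2].
  - exact: finite_sym.
have p1 : 1 < p := ltn_trans (isT : 1 < 3) p4.
pose par (i : 'Z_p) := odd i.
have even_p : odd (Zp_trunc p).+2 = false by rewrite Zp_cast // (negbTE p_even).
have parD i j : par (i + j)%R = par i (+) par j.
  by rewrite /par -oddD; apply: odd_mod even_p.
have par1 : par 1%R = true by apply: (odd_mod 1 even_p).
have four_neq0 : (4 != 0 :> 'Z_p)%R.
  apply: (Zp_small_neq0 (p := p)); first exact: ltnW.
  by rewrite /= ltn_neqAle eq_sym p5.
have m1 : 1 < m by [].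
exists (sym (('Z_p + bool) * 'Z_m)), (spider m parD par1 four_neq0); split.
  split; [exact: spider_polytopal| |exact: spider_internal].
  by apply: spider_order => n; apply: Zp_nat_eq0.
split; last 1 first.
- eexists; split=> [j|j k jN kN]; first exact: spider_walks_halved.
  by apply: spider_walks_dihedral => //; apply: Nm.
- exists (@spider_swaps 'Z_p m); split; [exact: spider_swaps_1|exact: spider_swaps_r1|exact: spider_swaps_r2].
- exact: finite_sym.
Qed.

Lemma even_internal : exists P : polytope 3,
  [/\ internally_self_dual P /\ has_type P (Some p) (Some p), finite_set [set: P]
   & `I_N #<= [set: P]].
Proof.
have [G [h [[hP op Hr0] [_ finG [x [Hx xinj]]]]]] := even_halving.
exists (halved_polyhedron hP); split; [split| |].
- exact: halved_internal.
- by apply: halved_has_type => // -[p0]; move: p4; rewrite p0.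
- exact: finite_halved.
- exact: (halved_many_faces hP (fun j _ => Hx j) xinj).
Qed.

Lemma even_external : exists P : polytope 3,
  [/\ externally_self_dual P /\ has_type P (Some p) (Some p), finite_set [set: P]
   & `I_N #<= [set: P]].
Proof.
have [G [h [[hP op Hr0] [[chi [chi1 chi_r1 chi_r2]] finG [x [Hx xinj]]]]]] := even_halving.
have dP := doubled_polytopal hP chi1 chi_r1 chi_r2.
exists (halved_polyhedron dP); split; [split| |].
- exact: doubled_external.
- apply: halved_has_type; first by move=> -[p0]; move: p4; rewrite p0.
  exact: (doubled_order chi1 chi_r1 chi_r2 op).
- exact/finite_halved/doubled_finite.
- exact: (doubled_many_faces dP (fun j _ => Hx j) xinj).
Qed.

End EvenType.

Lemma infinite_halving : exists (G : groupType) (h : halving G),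
  [/\ polytopal h, group_order (hr1 h * hr2 h)%g None, halved h (hr0 h)
    & exists chi, r1_parity h chi].
Proof.
pose par (i : int) := odd `|i|.
have parD i j : par (i + j)%R = par i (+) par j by rewrite /par; lia.
have par1 : par 1%R = true by [].
have four_neq0 : (4 != 0 :> int)%R by [].
exists (sym ((int + bool) * 'Z_3)), (spider 3 parD par1 four_neq0).
split; [exact: spider_polytopal| |exact: spider_internal|].
  apply: spider_order => n; rewrite dvd0n natz; split=> [[->]//|/eqP -> //].
by exists (@spider_swaps int 3); split; [exact: spider_swaps_1|exact: spider_swaps_r1|exact: spider_swaps_r2].
Qed.

Lemma odd_internal p : 2 < p -> odd p ->
  exists P : polytope 3, internally_self_dual P /\ has_type P (Some p) (Some p).
Proof.
move=> p2 p_odd; exists (halved_polyhedron (odd_wreath_polytopal p2)); split.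
  exact/halved_internal/odd_wreath_internal.
apply: halved_has_type; first by move=> -[p0]; move: p2; rewrite p0.
by apply: (wreath_order false) => n; apply/Zp_nat_eq0/ltnW.
Qed.

Lemma odd_external p : 3 < p -> odd p ->
  exists P : polytope 3, externally_self_dual P /\ has_type P (Some p) (Some p).
Proof.
move=> p3 p_odd; have p4 : 4 < p.
  by rewrite ltn_neqAle p3 andbT; apply: contraTneq p_odd => <-.
exists (halved_polyhedron (three_swaps_polytopal p4)); split.
  exact: three_swaps_external.
apply: halved_has_type; first by move=> -[p0]; move: p4; rewrite p0.
by apply: (wreath_order ord0) => n; apply/Zp_nat_eq0/ltnW/ltnW/ltnW.
Qed.

Theorem theorem5p1 :
  (forall p : option nat, at_least 3 p ->
     exists P : polytope 3, internally_self_dual P /\ has_type P p p) /\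
  (forall p : option nat, at_least 4 p ->
     exists P : polytope 3, externally_self_dual P /\ has_type P p p) /\
  (forall p : nat, (3 <= p)%N -> ~~ odd p ->
     infinitely_many_polyhedra
       (fun P => internally_self_dual P /\ has_type P (Some p) (Some p)) /\
     infinitely_many_polyhedra
       (fun P => externally_self_dual P /\ has_type P (Some p) (Some p))).
Proof.
have even4 p : 2 < p -> ~~ odd p -> 3 < p.
  by rewrite (leq_eqVlt 3) => /predU1P[<-|].
have [G [h [hP oI Hr0 [chi [chi1 chi_r1 chi_r2]]]]] := infinite_halving.
split; [|split].
- case=> [p|_] /=.
    have [p_odd|p_even] := boolP (odd p) => p3; first exact: odd_internal.
    by have [P [? _ _]] := even_internal 0 (even4 _ p3 p_even) p_even; exists P.
  by exists (halved_polyhedron hP); split; [apply: halved_internal|apply: halved_has_type].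
- case=> [p|_] /=.
    have [p_odd|p_even] := boolP (odd p) => p4; first exact: odd_external.
    by have [P [? _ _]] := even_external 0 p4 p_even; exists P.
  exists (halved_polyhedron (doubled_polytopal hP chi1 chi_r1 chi_r2)).
  split; [exact: doubled_external|apply: halved_has_type => //].
  exact: (doubled_order chi1 chi_r1 chi_r2 oI).
move=> p p3 p_even; have p4 := even4 _ p3 p_even.
by split; apply: infinitely_many_unbounded => N; [apply: even_internal|apply: even_external].
Qed.
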